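(* Let $\mathcal{A},\mathcal{B}$ be unital $^*$-algebras over $\mathsf{C}$ with $^*$-actions of a Hopf $^*$-algebra $H$, and let $\mathcal{E}$ be an $H$-covariant $^*$-Morita equivalence $(\mathcal{B},\mathcal{A})$-bimodule. Then the $^*$-isomorphism $h_{\mathcal{E}}:\mathcal{Z}(\mathcal{A})\to\mathcal{Z}(\mathcal{B})$, determined by $h_{\mathcal{E}}(a)\cdot x=x\cdot a$ for all $x\in\mathcal{E}$, restricts to a $^*$-isomorphism $h_{\mathcal{E}}:\mathcal{Z}(\mathcal{A})^H\to\mathcal{Z}(\mathcal{B})^H$. Thus $([\mathcal{E}],a)\mapsto h_{\mathcal{E}}(a)$ defines an action $$h:\mathsf{Pic}^*_H(\mathcal{B},\mathcal{A})\times\mathcal{Z}(\mathcal{A})^H\longrightarrow\mathcal{Z}(\mathcal{B})^H$$ of the $H$-covariant $^*$-Picard groupoid (of unital $^*$-algebras) on $H$-invariant central elements; that is, $h_{\mathcal{E}}$ depends only on the isomorphism class $[\mathcal{E}]$, $h_{\mathcal{F}}\circ h_{\mathcal{E}}=h_{\mathcal{F}\widetilde{\otimes}\mathcal{E}}$ for composable $\mathcal{F},\mathcal{E}$, and $h_{\mathcal{A}}=\mathrm{id}$ for the canonical bimodule ${}_{\mathcal{A}}\mathcal{A}_{\mathcal{A}}$.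
   Context: **Ground ring.** $\mathsf{R}$ is an ordered ring (commutative, unital), $\mathsf{C}=\mathsf{R}(i)$ with $i^2=-1$, with complex conjugation. A $^*$-algebra over $\mathsf{C}$ is an associative $\mathsf{C}$-algebra with a $\mathsf{C}$-antilinear involutive antiautomorphism. Modules over unital algebras are unital and carry a compatible $\mathsf{C}$-module structure. $\mathcal{Z}(\mathcal{A})$ is the center and $\mathcal{Z}(\mathcal{A})^H=\{a\in\mathcal{Z}(\mathcal{A}): g\triangleright a=\epsilon(g)a\ \forall g\in H\}$. **Hopf $^*$-algebra.** $H$ is a Hopf algebra over $\mathsf{C}$ ($\Delta(g)=g_{(1)}\otimes g_{(2)}$, counit $\epsilon$, antipode $S$) which is also a $^*$-algebra such that $\Delta,\epsilon$ are $^*$-homomorphisms and $S(S(g)^* )^*=g$. A $^*$-action of $H$ on a unital $\mathcal{A}$ is a left $H$-module structure with $1_H\triangleright a=a$, $g\triangleright(ab)=(g_{(1)}\triangleright a)(g_{(2)}\triangleright b)$, $(g\triangleright a)^*=S(g)^*\triangleright a^*$, $g\triangleright1=\epsilon(g)1$. **Inner products.** An $\mathcal{A}$-valued inner product on a right $\mathcal{A}$-module is $\mathsf{C}$-sesquilinear (linear in the second argument) with $\langle x,y\cdot a\rangle=\langle x,y\rangle a$, $\langle x,y\rangle=\langle y,x\rangle^*$ (on left modules: left linear in the first argument). Non-degenerate: $\langle x,\cdot\rangle=0$ implies $x=0$. Full: its values span the algebra. **Equivalence bimodules.** An $H$-covariant $^*$-Morita equivalence bimodule is a $(\mathcal{B},\mathcal{A})$-bimodule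 $\mathcal{E}$ with full non-degenerate inner products ${}_{\mathcal{B}}\langle\cdot,\cdot\rangle$ (left $\mathcal{B}$-linear) and $\langle\cdot,\cdot\rangle_{\mathcal{A}}$ (right $\mathcal{A}$-linear) with $\langle b\cdot x,y\rangle_{\mathcal{A}}=\langle x,b^*\cdot y\rangle_{\mathcal{A}}$, ${}_{\mathcal{B}}\langle x\cdot a,y\rangle={}_{\mathcal{B}}\langle x,y\cdot a^*\rangle$, ${}_{\mathcal{B}}\langle x,y\rangle\cdot z=x\cdot\langle y,z\rangle_{\mathcal{A}}$, and an $H$-module structure with $g\triangleright\langle x,y\rangle_{\mathcal{A}}=\langle S(g_{(1)})^*\triangleright x,g_{(2)}\triangleright y\rangle_{\mathcal{A}}$, $g\triangleright{}_{\mathcal{B}}\langle x,y\rangle={}_{\mathcal{B}}\langle g_{(1)}\triangleright x,S(g_{(2)})^*\triangleright y\rangle$. Isomorphisms are $H$-equivariant bimodule isomorphisms preserving both inner products; $\mathsf{Pic}^*_H(\mathcal{B},\mathcal{A})$ is the set of isomorphism classes, composed via $\widetilde{\otimes}$. Known fact: for every $a\in\mathcal{Z}(\mathcal{A})$ there is a unique $h_{\mathcal{E}}(a)\in\mathcal{Z}(\mathcal{B})$ with $h_{\mathcal{E}}(a)\cdot x=x\cdot a$ for all $x$, and $h_{\mathcal{E}}$ is a $^*$-isomorphism $\mathcal{Z}(\mathcal{A})\to\mathcal{Z}(\mathcal{B})$. **Operations.** $\mathcal{F}\widetilde{\otimes}_{\mathcal{B}}\mathcal{E}$ is $\mathcal{F}\otimes_{\mathcal{B}}\mathcal{E}$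 with $\langle y\otimes x,y'\otimes x'\rangle_{\mathcal{A}}=\langle x,\langle y,y'\rangle_{\mathcal{B}}\cdot x'\rangle_{\mathcal{A}}$ and ${}_{\mathcal{C}}\langle y\otimes x,y'\otimes x'\rangle={}_{\mathcal{C}}\langle y\cdot{}_{\mathcal{B}}\langle x,x'\rangle,y'\rangle$, divided by the (common) degeneracy space, with $g\triangleright(y\otimes x)=g_{(1)}\triangleright y\otimes g_{(2)}\triangleright x$. ${}_{\mathcal{A}}\mathcal{A}_{\mathcal{A}}$ carries $\langle a,b\rangle_{\mathcal{A}}=a^*b$, ${}_{\mathcal{A}}\langle a,b\rangle=ab^*$. *)

(* Defs.v *)
From HB Require Import structures.
From mathcomp Require Import all_boot all_order all_algebra.
From mathcomp Require Import boolp classical_sets.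
From mathcomp Require Import complex.

Set Implicit Arguments.
Unset Strict Implicit.
Unset Printing Implicit Defensive.

Import GRing.Theory.
Local Open Scope ring_scope.
Local Open Scope quotient_scope.

(* The ring C = R(i).  The ring structure that real_closed.complex puts on
   R[i] needs a field R, hence the alias. *)
Definition cplx (R : realDomainType) : Type := complex R.

Section Cplx.
Variable R : realDomainType.

HB.instance Definition _ := GRing.Zmodule.copy (cplx R) (complex R).

Definition cplx_mul : cplx R -> cplx R -> cplx R := @ComplexField.mulc R.
Definition cplx_one : cplx R := Complex 1 0.

Fact cplx_mulA : associative cplx_mul. Proof. exact: ComplexField.mulcA. Qed.
Fact cplx_mulC : commutative cplx_mul. Proof. exact: ComplexField.mulcC. Qed.
Fact cplx_mul1 : left_id cplx_one cplx_mul.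
Proof.
by case=> a b; rewrite /cplx_mul /cplx_one /= !mul1r !mul0r subr0 addr0.
Qed.
Fact cplx_mulDl : left_distributive cplx_mul +%R.
Proof.
move=> [a b] [c d] [e f]; rewrite /cplx_mul /=.
rewrite -[RHS]/(Complex (a * e - b * f + (c * e - d * f))
                        (a * f + b * e + (c * f + d * e))).
by rewrite !mulrDl !opprD -!addrA; congr (Complex (_ + _) (_ + _));
  rewrite addrCA.
Qed.
Fact cplx_oner_neq0 : cplx_one != 0.
Proof. by rewrite /cplx_one eq_complex /= oner_eq0. Qed.

HB.instance Definition _ := GRing.Zmodule_isComNzRing.Build (cplx R)
  cplx_mulA cplx_mulC cplx_mul1 cplx_mulDl cplx_oner_neq0.

Definition conj (c : cplx R) : cplx R := conjc c.

End Cplx.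

(** * Balanced tensor products *)

(* The data over which F (x) E is balanced: [bal_r] is the right action on F,
   [bal_l] the left action on E.  Taking [scale_balancing] gives the tensor
   product over K, and the actions of an algebra B give F (x)_B E. *)
Record balancing (K : pzRingType) (F E : lmodType K) := Balancing {
  bal_idx : Type;
  bal_r : F -> bal_idx -> F;
  bal_l : bal_idx -> E -> E;
  bal_scale : forall c x k, bal_r (c *: x) k = c *: bal_r x k }.

Arguments bal_r {K F E} b.
Arguments bal_l {K F E} b.

Fact scale_balancing_subproof (K : comPzRingType) (F : lmodType K) (c : K)
  (x : F) (k : K) : k *: (c *: x) = c *: (k *: x).
Proof. by rewrite !scalerA mulrC. Qed.

Definition scale_balancing (K : comPzRingType) (F E : lmodType K) :
    balancing F E :=
  @Balancing K F E K (fun x k => k *: x) (fun k y => k *: y)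
    (@scale_balancing_subproof K F).

Section Tensor.
Variables (K : pzRingType) (F E : lmodType K) (b : balancing F E).

(* A list of pairs stands for the formal sum of the corresponding x (x) y. *)
Inductive tens_rel : seq (F * E) -> seq (F * E) -> Prop :=
| TRrefl s : tens_rel s s
| TRsym s t : tens_rel s t -> tens_rel t s
| TRtrans s t u : tens_rel s t -> tens_rel t u -> tens_rel s u
| TRcat s s' t t' :
    tens_rel s s' -> tens_rel t t' -> tens_rel (s ++ t) (s' ++ t')
| TRcomm s t : tens_rel (s ++ t) (t ++ s)
| TRzero y : tens_rel [:: (0, y)] [::]
| TRaddl x x' y : tens_rel [:: (x + x', y)] [:: (x, y); (x', y)]
| TRaddr x y y' : tens_rel [:: (x, y + y')] [:: (x, y); (x, y')]
| TRbal x k y : tens_rel [:: (bal_r b x k, y)] [:: (x, bal_l b k y)].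

Definition tens_eqb s t := `[< tens_rel s t >].

Fact tens_eqb_equiv : equiv_class_of tens_eqb.
Proof.
split=> [s|s t|t s u].
- exact/asboolP/TRrefl.
- by apply/asboolP/asboolP => /TRsym.
- by move=> /asboolP st /asboolP tu; apply/asboolP/(TRtrans st).
Qed.
Canonical tens_equiv := EquivRelPack tens_eqb_equiv.
Canonical tens_encModRel := defaultEncModRel tens_eqb.

Definition tensor := {eq_quot tens_eqb}.
HB.instance Definition _ : EqQuotient _ tens_eqb tensor := EqQuotient.on tensor.
HB.instance Definition _ := Choice.on tensor.

Lemma tens_piP s t : tens_rel s t <-> \pi_tensor s = \pi_tensor t.
Proof.
split=> [/asboolP st|/eqP]; first by apply/eqP; rewrite piE.
by rewrite piE => /asboolP.
Qed.

Lemma repr_tens s : tens_rel (repr (\pi_tensor s)) s.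
Proof. by apply/tens_piP; rewrite reprK. Qed.

Definition tens (x : F) (y : E) : tensor := \pi_tensor [:: (x, y)].

Definition tens_add (s t : tensor) : tensor :=
  locked (\pi_tensor (repr s ++ repr t)).
Definition tens_opp (s : tensor) : tensor :=
  locked (\pi_tensor [seq (- p.1, p.2) | p <- repr s]).
Definition tens_scale (c : K) (s : tensor) : tensor :=
  locked (\pi_tensor [seq (c *: p.1, p.2) | p <- repr s]).

Lemma tens_map (f : F -> F) s t :
  {morph f : x y / x + y} -> (forall x k, f (bal_r b x k) = bal_r b (f x) k) ->
  tens_rel s t ->
  tens_rel [seq (f p.1, p.2) | p <- s] [seq (f p.1, p.2) | p <- t].
Proof.
move=> fD fb; elim=> {s t} /=.
- by move=> s; apply: TRrefl.
- by move=> s t _; apply: TRsym.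
- by move=> s t u _ h _; apply: TRtrans.
- by move=> s s' t t' _ h _ h'; rewrite !map_cat; apply: TRcat.
- by move=> s t; rewrite !map_cat; apply: TRcomm.
- move=> y; have -> : f 0 = 0 by apply: (addrI (f 0)); rewrite -fD !addr0.
  exact: TRzero.
- by move=> x x' y; rewrite fD; apply: TRaddl.
- by move=> x y y'; apply: TRaddr.
- by move=> x k y; rewrite fb; apply: TRbal.
Qed.

Lemma tens_addE s t :
  tens_add (\pi_tensor s) (\pi_tensor t) = \pi_tensor (s ++ t).
Proof.
by rewrite /tens_add -lock; apply/tens_piP/TRcat; apply: repr_tens.
Qed.

Lemma tens_oppE s :
  tens_opp (\pi_tensor s) = \pi_tensor [seq (- p.1, p.2) | p <- s].
Proof.
rewrite -[LHS]lock; apply/tens_piP/(@tens_map -%R); last exact: repr_tens.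
  exact: opprD.
by move=> x k; rewrite -!scaleN1r bal_scale.
Qed.

Lemma tens_scaleE c s :
  tens_scale c (\pi_tensor s) = \pi_tensor [seq (c *: p.1, p.2) | p <- s].
Proof.
rewrite -[LHS]lock; apply/tens_piP/(@tens_map (fun x => c *: x)); last exact: repr_tens.
  exact: scalerDr.
by move=> x k; rewrite bal_scale.
Qed.

Fact tens_addA : associative tens_add.
Proof.
move=> s t u; rewrite -[s]reprK -[t]reprK -[u]reprK.
by rewrite !tens_addE catA.
Qed.

Fact tens_addC : commutative tens_add.
Proof.
move=> s t; rewrite -[s]reprK -[t]reprK !tens_addE.
exact/tens_piP/TRcomm.
Qed.

Fact tens_add0 : left_id (\pi_tensor [::]) tens_add.
Proof. by move=> s; rewrite -[s]reprK tens_addE. Qed.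

Fact tens_addN : left_inverse (\pi_tensor [::]) tens_opp tens_add.
Proof.
move=> s; rewrite -[s]reprK tens_oppE tens_addE; apply/tens_piP.
elim: (repr s) => [|[x y] t IHt] /=; first exact: TRrefl.
set t' := map _ t in IHt *.
apply: (TRtrans (t := [:: (- x, y); (x, y)] ++ (t' ++ t))).
  have h : tens_rel (t' ++ [:: (x, y)] ++ t) ([:: (x, y)] ++ (t' ++ t)).
    rewrite catA [X in tens_rel _ X]catA.
    by apply: TRcat (TRcomm _ _) (TRrefl _).
  exact: (TRcat (TRrefl [:: (- x, y)]) h).
have h : tens_rel [:: (- x, y); (x, y)] [::].
  by apply: TRtrans (TRsym (TRaddl _ _ _)) _; rewrite addNr; apply: TRzero.
exact: (TRcat h IHt).
Qed.

HB.instance Definition _ := GRing.isZmodule.Build tensor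
  tens_addA tens_addC tens_add0 tens_addN.

Fact tens_scaleA c d s : tens_scale c (tens_scale d s) = tens_scale (c * d) s.
Proof.
rewrite -[s]reprK !tens_scaleE -map_comp; congr \pi.
by apply: eq_map => p /=; rewrite scalerA.
Qed.

Fact tens_scale1 : left_id 1 tens_scale.
Proof.
move=> s; rewrite -[s]reprK tens_scaleE; congr \pi.
by rewrite -[RHS]map_id; apply: eq_map => -[x y] /=; rewrite scale1r.
Qed.

Fact tens_scaleDr : right_distributive tens_scale +%R.
Proof.
move=> c s t; rewrite -[s]reprK -[t]reprK !tens_scaleE.
by rewrite -![_ + _]/(tens_add _ _) !tens_addE tens_scaleE map_cat.
Qed.

Fact tens_scaleDl s : {morph tens_scale^~ s : c d / c + d}.
Proof.
move=> c d; rewrite -[s]reprK !tens_scaleE -[RHS]/(tens_add _ _) tens_addE.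
apply/tens_piP; elim: (repr s) => [|[x y] t IHt] /=; first exact: TRrefl.
set u := map _ t in IHt *; set v := map _ t in IHt *; set w := map _ t in IHt *.
have h : tens_rel ([:: (d *: x, y)] ++ (v ++ w)) (v ++ [:: (d *: x, y)] ++ w).
  rewrite catA [X in tens_rel _ X]catA.
  by apply: TRcat (TRcomm _ _) (TRrefl _).
rewrite scalerDl; apply: TRtrans (TRcat (TRrefl [:: (c *: x, y)]) h).
exact: (TRcat (TRaddl (c *: x) (d *: x) y) IHt).
Qed.

HB.instance Definition _ := GRing.Zmodule_isLmodule.Build K tensor
  tens_scaleA tens_scale1 tens_scaleDr tens_scaleDl.

Lemma tens_pi_sum s : \pi_tensor s = \sum_(p <- s) tens p.1 p.2.
Proof.
elim: s => [|[x y] s IHs]; first by rewrite big_nil.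
by rewrite big_cons -IHs -[RHS]/(tens_add _ _) tens_addE.
Qed.

Lemma tens_sum (t : tensor) : t = \sum_(p <- repr t) tens p.1 p.2.
Proof. by rewrite -tens_pi_sum reprK. Qed.

Lemma tens_ind (P : tensor -> Prop) :
  P 0 -> (forall x y, P (tens x y)) -> (forall s t, P s -> P t -> P (s + t)) ->
  forall t, P t.
Proof.
move=> P0 Pt PD t; rewrite (tens_sum t).
by elim: (repr t) => [|p s IHs]; rewrite ?big_nil ?big_cons //; apply: PD.
Qed.

Lemma tensDl x x' y : tens (x + x') y = tens x y + tens x' y.
Proof. by rewrite -[RHS]/(tens_add _ _) tens_addE; apply/tens_piP/TRaddl. Qed.

Lemma tensDr x y y' : tens x (y + y') = tens x y + tens x y'.
Proof. by rewrite -[RHS]/(tens_add _ _) tens_addE; apply/tens_piP/TRaddr. Qed.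

Lemma tens_bal x k y : tens (bal_r b x k) y = tens x (bal_l b k y).
Proof. exact/tens_piP/TRbal. Qed.

Lemma tensZl c x y : tens (c *: x) y = c *: tens x y.
Proof. by rewrite -[RHS]/(tens_scale _ _) tens_scaleE. Qed.

(* The extension of a balanced map [f] to the tensor product. *)
Definition tlift (M : zmodType) (f : F -> E -> M) (t : tensor) : M :=
  \sum_(p <- repr t) f p.1 p.2.

Record balanced (M : zmodType) (f : F -> E -> M) : Prop := Balanced {
  balancedDl : forall y, {morph f ^~ y : x x' / x + x'};
  balancedDr : forall x, {morph f x : y y' / y + y'};
  balanced_bal : forall x k y, f (bal_r b x k) y = f x (bal_l b k y) }.

Section Lift.
Variables (M : zmodType) (f : F -> E -> M).
Hypothesis fB : balanced f.

Lemma tens_rel_lift s t : tens_rel s t ->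
  \sum_(p <- s) f p.1 p.2 = \sum_(p <- t) f p.1 p.2.
Proof.
elim=> {s t} //=.
- by move=> s t u _ -> _ ->.
- by move=> s s' t t' _ h _ h'; rewrite !big_cat /= h h'.
- by move=> s t; rewrite !big_cat /= addrC.
- move=> y; rewrite big_nil big_seq1 /=.
  by apply: (addrI (f 0 y)); rewrite -(balancedDl fB) !addr0.
- by move=> x x' y; rewrite !big_cons !big_nil !addr0 /= (balancedDl fB).
- by move=> x y y'; rewrite !big_cons !big_nil !addr0 /= (balancedDr fB).
- by move=> x k y; rewrite !big_seq1 /= (balanced_bal fB).
Qed.

Lemma tlift_pi s : tlift f (\pi_tensor s) = \sum_(p <- s) f p.1 p.2.
Proof. exact/tens_rel_lift/repr_tens. Qed.

Lemma tliftE x y : tlift f (tens x y) = f x y.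
Proof. by rewrite tlift_pi big_seq1. Qed.

Lemma tliftD : {morph tlift f : s t / s + t}.
Proof.
move=> s t; rewrite -[s]reprK -[t]reprK -[_ + _]/(tens_add _ _) tens_addE.
by rewrite !tlift_pi big_cat.
Qed.

Lemma tlift0 : tlift f 0 = 0.
Proof. by rewrite -[0]/(\pi_tensor [::]) tlift_pi big_nil. Qed.

Lemma tlift_sum I (r : seq I) (G : I -> tensor) :
  tlift f (\sum_(i <- r) G i) = \sum_(i <- r) tlift f (G i).
Proof. exact: (big_morph _ tliftD tlift0). Qed.

End Lift.

End Tensor.

(** * Star-algebras and Hopf star-algebras *)

(* [lalgType] and [algType] demand 1 != 0, so they would exclude the zero
   algebra; hence this record of a ring with a scalar multiplication. *)
Record starAlgebra (R : realDomainType) := StarAlgebra {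
  sa_ring : pzRingType;
  sa_scale : cplx R -> sa_ring -> sa_ring;
  sa_scaleA : forall c d x, sa_scale c (sa_scale d x) = sa_scale (c * d) x;
  sa_scale1 : left_id 1 sa_scale;
  sa_scaleDr : right_distributive sa_scale +%R;
  sa_scaleDl : forall x, {morph sa_scale^~ x : c d / c + d};
  sa_scaleAl : forall c x y, sa_scale c (x * y) = sa_scale c x * y;
  sa_scaleAr : forall c x y, sa_scale c (x * y) = x * sa_scale c y;
  sa_star : sa_ring -> sa_ring;
  sa_star_antilinear : forall c x y,
    sa_star (sa_scale c x + y) = sa_scale (conj c) (sa_star x) + sa_star y;
  sa_starM : forall x y, sa_star (x * y) = sa_star y * sa_star x;
  sa_starK : involutive sa_star }.

Definition sa_sort (R : realDomainType) (A : starAlgebra R) : Type := sa_ring A.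
Coercion sa_sort : starAlgebra >-> Sortclass.

HB.instance Definition _ (R : realDomainType) (A : starAlgebra R) :=
  GRing.PzRing.copy (sa_sort A) (sa_ring A).
HB.instance Definition _ (R : realDomainType) (A : starAlgebra R) :=
  GRing.Zmodule_isLmodule.Build (cplx R) (sa_sort A) (@sa_scaleA R A)
    (@sa_scale1 R A) (@sa_scaleDr R A) (@sa_scaleDl R A).

Definition star (R : realDomainType) (A : starAlgebra R) : A -> A :=
  @sa_star R A.

Section StarAlgebraTheory.
Variables (R : realDomainType) (A : starAlgebra R).
Implicit Types (x y : A) (c : cplx R).

Lemma saAl c x y : c *: (x * y) = (c *: x) * y. Proof. exact: sa_scaleAl. Qed.
Lemma saAr c x y : c *: (x * y) = x * (c *: y). Proof. exact: sa_scaleAr. Qed.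
Lemma star_antilinear c x y : star (c *: x + y) = conj c *: star x + star y.
Proof. exact: sa_star_antilinear. Qed.
Lemma starM x y : star (x * y) = star y * star x. Proof. exact: sa_starM. Qed.
Lemma starK : involutive (@star R A). Proof. exact: sa_starK. Qed.

Lemma conj1 : conj 1 = 1 :> cplx R.
Proof. by rewrite /conj /= oppr0. Qed.

Lemma conjK : involutive (@conj R).
Proof. by case=> a b; rewrite /conj /= opprK. Qed.

Lemma starD x y : star (x + y) = star x + star y.
Proof. by rewrite -[x]scale1r star_antilinear conj1 !scale1r. Qed.
Lemma star0 : star (0 : A) = 0.
Proof. by apply: (addrI (star 0)); rewrite -starD !addr0. Qed.
Lemma starZ c x : star (c *: x) = conj c *: star x.
Proof. by rewrite -[c *: x]addr0 star_antilinear star0 addr0. Qed.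
Lemma star1 : star (1 : A) = 1.
Proof. by rewrite -[LHS]mul1r -[X in X * _]starK -starM mul1r starK. Qed.
Lemma star_sum I (r : seq I) (f : I -> A) :
  star (\sum_(i <- r) f i) = \sum_(i <- r) star (f i).
Proof. exact: (big_morph _ starD star0). Qed.

End StarAlgebraTheory.

Definition ctensor (R : realDomainType) (F E : lmodType (cplx R)) :=
  tensor (scale_balancing F E).
HB.instance Definition _ R F E := GRing.Lmodule.on (@ctensor R F E).

Definition ctens (R : realDomainType) (F E : lmodType (cplx R)) (x : F)
    (y : E) : ctensor F E :=
  tens (scale_balancing F E) x y.

(* [repr (ho_cop g)] is a list of pairs (g_(1), g_(2)) whose pure tensors sum
   to the coproduct of g, so the sums over it below read as in Sweedler's
   notation. *)
Record hopfStarAlgebra (R : realDomainType) := HopfStarAlgebra {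
  ho_alg :> starAlgebra R;
  ho_cop : ho_alg -> ctensor ho_alg ho_alg;
  ho_eps : ho_alg -> cplx R;
  ho_antip : ho_alg -> ho_alg;
  ho_cop_linear : linear ho_cop;
  ho_eps_linear : forall c g h, ho_eps (c *: g + h) = c * ho_eps g + ho_eps h;
  ho_antip_linear : linear ho_antip;
  ho_coassoc : forall g,
    \sum_(p <- repr (ho_cop g)) \sum_(q <- repr (ho_cop p.1))
      ctens q.1 (ctens q.2 p.2) =
    \sum_(p <- repr (ho_cop g)) \sum_(q <- repr (ho_cop p.2))
      ctens p.1 (ctens q.1 q.2);
  ho_counitl : forall g, \sum_(p <- repr (ho_cop g)) ho_eps p.1 *: p.2 = g;
  ho_counitr : forall g, \sum_(p <- repr (ho_cop g)) ho_eps p.2 *: p.1 = g;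
  ho_cop1 : ho_cop 1 = ctens (1 : ho_alg) (1 : ho_alg);
  ho_copM : forall g h : ho_alg, ho_cop (g * h) =
    \sum_(p <- repr (ho_cop g)) \sum_(q <- repr (ho_cop h))
      ctens (p.1 * q.1) (p.2 * q.2);
  ho_eps1 : ho_eps 1 = 1;
  ho_epsM : forall g h : ho_alg, ho_eps (g * h) = ho_eps g * ho_eps h;
  ho_antipl : forall g,
    \sum_(p <- repr (ho_cop g)) ho_antip p.1 * p.2 = ho_eps g *: (1 : ho_alg);
  ho_antipr : forall g,
    \sum_(p <- repr (ho_cop g)) p.1 * ho_antip p.2 = ho_eps g *: (1 : ho_alg);
  ho_cop_star : forall g, ho_cop (star g) =
    \sum_(p <- repr (ho_cop g)) ctens (star p.1) (star p.2);
  ho_eps_star : forall g, ho_eps (star g) = conj (ho_eps g);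
  ho_antip_star : forall g, star (ho_antip (star (ho_antip g))) = g }.

Arguments ho_eps {R _}.
Arguments ho_antip {R _}.

Definition sweedler (R : realDomainType) (H : hopfStarAlgebra R) (g : H) :
    seq (H * H) :=
  repr (ho_cop g).

(* A star-action of H on a unital star-algebra. *)
Record hAlgebra (R : realDomainType) (H : hopfStarAlgebra R) := HAlgebra {
  ha_alg :> starAlgebra R;
  ha_act : H -> ha_alg -> ha_alg;
  ha_actl : forall a, linear (ha_act ^~ a);
  ha_actr : forall g, linear (ha_act g);
  ha_act1 : forall a, ha_act 1 a = a;
  ha_actA : forall (g h : H) a, ha_act (g * h) a = ha_act g (ha_act h a);
  ha_actM : forall g (a b : ha_alg),
    ha_act g (a * b) = \sum_(p <- sweedler g) ha_act p.1 a * ha_act p.2 b;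
  ha_act_star : forall g a,
    star (ha_act g a) = ha_act (star (ho_antip g)) (star a);
  ha_act_one : forall g, ha_act g 1 = ho_eps g *: (1 : ha_alg) }.

Arguments ha_act {R H _}.

(** * Equivalence bimodules *)

(* An H-covariant (B, A)-bimodule with full inner products satisfying all the
   axioms of an equivalence bimodule except non-degeneracy.  Antilinearity of
   the inner products in the other argument follows from the hermitian
   symmetry. *)
Record preBimodule (R : realDomainType) (H : hopfStarAlgebra R)
    (B A : hAlgebra H) := PreBimodule {
  bm_mod :> lmodType (cplx R);
  lact : B -> bm_mod -> bm_mod;
  ract : bm_mod -> A -> bm_mod;
  hact : H -> bm_mod -> bm_mod;
  ipL : bm_mod -> bm_mod -> B;
  ipR : bm_mod -> bm_mod -> A;
  lact_linl : forall x, linear (lact ^~ x);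
  lact_linr : forall b, linear (lact b);
  lact1 : forall x, lact 1 x = x;
  lactA : forall b b' x, lact (b * b') x = lact b (lact b' x);
  ract_linl : forall a, linear (ract ^~ a);
  ract_linr : forall x, linear (ract x);
  ract1 : forall x, ract x 1 = x;
  ractA : forall x a a', ract x (a * a') = ract (ract x a) a';
  lractA : forall b x a, ract (lact b x) a = lact b (ract x a);
  hact_linl : forall x, linear (hact ^~ x);
  hact_linr : forall g, linear (hact g);
  hact1 : forall x, hact 1 x = x;
  hactA : forall g h x, hact (g * h) x = hact g (hact h x);
  ipR_lin : forall x, linear (ipR x);
  ipR_ract : forall x y a, ipR x (ract y a) = ipR x y * a;
  ipR_star : forall x y, ipR x y = star (ipR y x);
  ipR_full : forall a, exists s : seq (cplx R * (bm_mod * bm_mod)),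
    a = \sum_(p <- s) p.1 *: ipR p.2.1 p.2.2;
  ipL_lin : forall y, linear (ipL ^~ y);
  ipL_lact : forall b x y, ipL (lact b x) y = b * ipL x y;
  ipL_star : forall x y, ipL x y = star (ipL y x);
  ipL_full : forall b, exists s : seq (cplx R * (bm_mod * bm_mod)),
    b = \sum_(p <- s) p.1 *: ipL p.2.1 p.2.2;
  ipR_lact : forall b x y, ipR (lact b x) y = ipR x (lact (star b) y);
  ipL_ract : forall a x y, ipL (ract x a) y = ipL x (ract y (star a));
  ipLR : forall x y z, lact (ipL x y) z = ract x (ipR y z);
  ipR_hact : forall g x y, ha_act g (ipR x y) =
    \sum_(p <- sweedler g) ipR (hact (star (ho_antip p.1)) x) (hact p.2 y);
  ipL_hact : forall g x y, ha_act g (ipL x y) =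
    \sum_(p <- sweedler g) ipL (hact p.1 x) (hact (star (ho_antip p.2)) y) }.

Arguments lact {R H B A _}.
Arguments ract {R H B A _}.
Arguments hact {R H B A _}.
Arguments ipL {R H B A _}.
Arguments ipR {R H B A _}.

Record bimodule (R : realDomainType) (H : hopfStarAlgebra R)
    (B A : hAlgebra H) := Bimodule {
  bm_pre :> preBimodule B A;
  ipR_nondeg : forall x : bm_pre, (forall y, ipR x y = 0) -> x = 0;
  ipL_nondeg : forall x : bm_pre, (forall y, ipL x y = 0) -> x = 0 }.

(** ** Sweedler calculus *)

Record bilin (K : pzRingType) (U V W : lmodType K) (f : U -> V -> W) : Prop :=
  Bilin {
  bilinl : forall y, linear (f ^~ y);
  bilinr : forall x, linear (f x) }.

Section LinearTheory.
Variables (K : pzRingType) (U V : lmodType K) (f : U -> V).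
Hypothesis fL : linear f.

Lemma lin_D : {morph f : x y / x + y}.
Proof. by move=> x y; rewrite -[x]scale1r fL !scale1r. Qed.
Lemma lin_0 : f 0 = 0.
Proof. by apply: (addrI (f 0)); rewrite -lin_D !addr0. Qed.
Lemma lin_Z c x : f (c *: x) = c *: f x.
Proof. by rewrite -[c *: x]addr0 fL lin_0 addr0. Qed.
Lemma lin_sum I (r : seq I) (G : I -> U) :
  f (\sum_(i <- r) G i) = \sum_(i <- r) f (G i).
Proof. exact: (big_morph _ lin_D lin_0). Qed.

End LinearTheory.

Lemma sum_linear (K : pzRingType) (U V : lmodType K) I (r : seq I)
    (f : I -> U -> V) :
  (forall i, linear (f i)) -> linear (fun x => \sum_(i <- r) f i x).
Proof.
move=> fL c x y; rewrite scaler_sumr -big_split /=.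
by apply: eq_bigr => i _; rewrite fL.
Qed.

Lemma bilin_balanced (K : comPzRingType) (U V W : lmodType K)
    (f : U -> V -> W) :
  bilin f -> balanced (scale_balancing U V) f.
Proof.
case=> fl fr; split=> [y|x|x k y].
- exact: (lin_D (fl y)).
- exact: (lin_D (fr x)).
- by rewrite /= (lin_Z (fl y)) (lin_Z (fr x)).
Qed.

Section Sweedler.
Variables (R : realDomainType) (H : hopfStarAlgebra R).
Local Notation C := (cplx R).
Implicit Types (g h : H).

Lemma sweedler_lift (M : lmodType C) (f : H -> H -> M) I (r : seq I)
    (u v : I -> H) g : bilin f ->
  ho_cop g = \sum_(i <- r) ctens (u i) (v i) ->
  \sum_(p <- sweedler g) f p.1 p.2 = \sum_(i <- r) f (u i) (v i).
Proof.
move=> /bilin_balanced fB e; rewrite -[LHS]/(tlift f (ho_cop g)) e.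
by rewrite (tlift_sum fB); apply: eq_bigr => i _; rewrite (tliftE fB).
Qed.

Lemma sweedler_linear (M : lmodType C) (f : H -> H -> M) :
  bilin f -> linear (fun g => \sum_(p <- sweedler g) f p.1 p.2).
Proof.
move=> fL c g h.
have fB := bilin_balanced fL.
rewrite -[LHS]/(tlift f (ho_cop _)) ho_cop_linear.
rewrite -[X in _ = c *: X + _]/(tlift f (ho_cop g)).
rewrite -[X in _ = _ + X]/(tlift f (ho_cop h)).
rewrite (tliftD fB); congr (_ + _).
elim/tens_ind: (ho_cop g) => [|x y|s t IHs IHt].
- by rewrite scaler0 !(tlift0 fB) scaler0.
- by rewrite -tensZl !(tliftE fB) (lin_Z (bilinl fL y)).
- by rewrite scalerDr !(tliftD fB) scalerDr IHs IHt.
Qed.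

Lemma sweedler1 (M : lmodType C) (f : H -> H -> M) : bilin f ->
  \sum_(p <- sweedler (1 : H)) f p.1 p.2 = f 1 1.
Proof.
move=> fL; rewrite (sweedler_lift (r := [:: tt]) (u := fun=> 1)
  (v := fun=> 1) fL) ?big_seq1 //.
exact: ho_cop1.
Qed.

Lemma sweedlerM (M : lmodType C) (f : H -> H -> M) g h : bilin f ->
  \sum_(p <- sweedler (g * h)) f p.1 p.2 =
  \sum_(p <- sweedler g) \sum_(q <- sweedler h) f (p.1 * q.1) (p.2 * q.2).
Proof.
move=> fL; rewrite (sweedler_lift
  (r := [seq (p, q) | p <- sweedler g, q <- sweedler h])
  (u := fun i => i.1.1 * i.2.1) (v := fun i => i.1.2 * i.2.2) fL).
  by rewrite big_allpairs.
by rewrite ho_copM big_allpairs.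
Qed.

Lemma sweedler_star (M : lmodType C) (f : H -> H -> M) g : bilin f ->
  \sum_(p <- sweedler (star g)) f p.1 p.2 =
  \sum_(p <- sweedler g) f (star p.1) (star p.2).
Proof. by move=> fL; apply: (sweedler_lift fL); apply: ho_cop_star. Qed.

Lemma sweedlerA (M : lmodType C) (f : H -> H -> H -> M) g :
  (forall y z, linear (fun x => f x y z)) ->
  (forall x z, linear (fun y => f x y z)) ->
  (forall x y, linear (f x y)) ->
  \sum_(p <- sweedler g) \sum_(q <- sweedler p.1) f q.1 q.2 p.2 =
  \sum_(p <- sweedler g) \sum_(q <- sweedler p.2) f p.1 q.1 q.2.
Proof.
move=> f1 f2 f3.
have fB x : balanced (scale_balancing H H) (f x).
  by apply: bilin_balanced; split=> [z|y]; [apply: f2|apply: f3].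
have FB : balanced (scale_balancing H (ctensor H H))
    (fun x (t : ctensor H H) => tlift (f x) t).
  split=> [t x x'|x|x k t].
  - rewrite /tlift -big_split /=; apply: eq_bigr => p _.
    exact: (lin_D (f1 _ _)).
  - exact: (tliftD (fB x)).
  - rewrite /= -[RHS]/(tlift (f x) _); elim/tens_ind: t => [|y z|s t IHs IHt].
    + by rewrite scaler0 !(tlift0 (fB _)).
    + rewrite -tensZl !(tliftE (fB _)) (lin_Z (f1 _ _)).
      by rewrite (lin_Z (f2 _ _)).
    + by rewrite scalerDr !(tliftD (fB _)) IHs IHt.
have := congr1 (fun t => tlift (fun x s => tlift (f x) s) t) (ho_coassoc g).
rewrite !(tlift_sum FB) => e; move: e.
under eq_bigr => p _ do
  (rewrite (tlift_sum FB); under eq_bigr => q _ do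
    rewrite (tliftE FB) (tliftE (fB _))).
under [X in _ = X -> _]eq_bigr => p _ do
  (rewrite (tlift_sum FB); under eq_bigr => q _ do
    rewrite (tliftE FB) (tliftE (fB _))).
exact.
Qed.

Lemma saPl (A : starAlgebra R) c (x y z : A) :
  (c *: x + y) * z = c *: (x * z) + y * z.
Proof. by rewrite mulrDl saAl. Qed.

Lemma saPr (A : starAlgebra R) c (x y z : A) :
  z * (c *: x + y) = c *: (z * x) + z * y.
Proof. by rewrite mulrDr saAr. Qed.

Lemma antipP c g h :
  ho_antip (c *: g + h) = c *: ho_antip g + ho_antip h.
Proof. exact: ho_antip_linear. Qed.

Section Cancel.
Variables (M : lmodType C) (f : H -> H -> M).
Hypothesis fL : bilin f.

Lemma sweedler_eps1 g :
  \sum_(p <- sweedler g) f (ho_eps p.1 *: (1 : H)) p.2 = f 1 g.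
Proof.
rewrite -[in RHS](ho_counitl g) (lin_sum (bilinr fL _)).
apply: eq_bigr => p _.
by rewrite (lin_Z (bilinl fL _)) (lin_Z (bilinr fL _)).
Qed.

Lemma sweedler_eps2 g :
  \sum_(p <- sweedler g) f p.1 (ho_eps p.2 *: (1 : H)) = f g 1.
Proof.
rewrite -[in RHS](ho_counitr g) (lin_sum (bilinl fL _)).
apply: eq_bigr => p _.
by rewrite (lin_Z (bilinl fL _)) (lin_Z (bilinr fL _)).
Qed.

Lemma sweedlerA_mulS g :
  \sum_(p <- sweedler g) \sum_(q <- sweedler p.2) f (p.1 * ho_antip q.1) q.2 =
  f 1 g.
Proof.
rewrite -(@sweedlerA _ (fun x y z => f (x * ho_antip y) z)).
- rewrite -sweedler_eps1; apply: eq_bigr => p _.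
  by rewrite -(lin_sum (bilinl fL _)) ho_antipr.
- by move=> y z c x x'; rewrite saPl (bilinl fL).
- by move=> x z c y y'; rewrite antipP saPr (bilinl fL).
- by move=> x y; apply: bilinr.
Qed.

Lemma sweedlerA_Smul g :
  \sum_(p <- sweedler g) \sum_(q <- sweedler p.2) f (ho_antip p.1 * q.1) q.2 =
  f 1 g.
Proof.
rewrite -(@sweedlerA _ (fun x y z => f (ho_antip x * y) z)).
- rewrite -sweedler_eps1; apply: eq_bigr => p _.
  by rewrite -(lin_sum (bilinl fL _)) ho_antipl.
- by move=> y z c x x'; rewrite antipP saPl (bilinl fL).
- by move=> x z c y y'; rewrite saPr (bilinl fL).
- by move=> x y; apply: bilinr.
Qed.

Lemma sweedlerA_mulSr g :
  \sum_(p <- sweedler g) \sum_(q <- sweedler p.1) f q.1 (q.2 * ho_antip p.2) =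
  f g 1.
Proof.
rewrite (@sweedlerA _ (fun x y z => f x (y * ho_antip z))).
- rewrite -sweedler_eps2; apply: eq_bigr => p _.
  by rewrite -(lin_sum (bilinr fL _)) ho_antipr.
- by move=> y z; apply: bilinl.
- by move=> x z c y y'; rewrite saPl (bilinr fL).
- by move=> x y c z z'; rewrite antipP saPr (bilinr fL).
Qed.

End Cancel.

End Sweedler.

(** ** Bimodules *)

Section HAlgebraTheory.
Variables (R : realDomainType) (H : hopfStarAlgebra R) (A : hAlgebra H).

Lemma haPl c (g h : H) (a : A) :
  ha_act (c *: g + h) a = c *: ha_act g a + ha_act h a.
Proof. exact: ha_actl. Qed.
Lemma haPr c (g : H) (a b : A) :
  ha_act g (c *: a + b) = c *: ha_act g a + ha_act g b.
Proof. exact: ha_actr. Qed.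
Lemma ha_act0 (g : H) : ha_act g (0 : A) = 0.
Proof. exact: (lin_0 (ha_actr g)). Qed.

End HAlgebraTheory.

Section PreBimoduleTheory.
Variables (R : realDomainType) (H : hopfStarAlgebra R) (B A : hAlgebra H).
Variable P : preBimodule B A.
Implicit Types (x y z : P) (a : A) (b : B) (g h : H) (c : cplx R).

Lemma lactPl c b b' x : lact (c *: b + b') x = c *: lact b x + lact b' x.
Proof. exact: lact_linl. Qed.
Lemma lactPr c b x y : lact b (c *: x + y) = c *: lact b x + lact b y.
Proof. exact: lact_linr. Qed.
Lemma ractPl c a x y : ract (c *: x + y) a = c *: ract x a + ract y a.
Proof. exact: ract_linl. Qed.
Lemma ractPr c a a' x : ract x (c *: a + a') = c *: ract x a + ract x a'.
Proof. exact: ract_linr. Qed.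
Lemma hactPl c g h x : hact (c *: g + h) x = c *: hact g x + hact h x.
Proof. exact: hact_linl. Qed.
Lemma hactPr c g x y : hact g (c *: x + y) = c *: hact g x + hact g y.
Proof. exact: hact_linr. Qed.
Lemma ipRPr c x y z : ipR x (c *: y + z) = c *: ipR x y + ipR x z.
Proof. exact: ipR_lin. Qed.
Lemma ipRPl c x y z : ipR (c *: x + y) z = conj c *: ipR x z + ipR y z.
Proof. by rewrite ipR_star ipRPr star_antilinear -!ipR_star. Qed.
Lemma ipLPl c x y z : ipL (c *: x + y) z = c *: ipL x z + ipL y z.
Proof. exact: ipL_lin. Qed.
Lemma ipLPr c x y z : ipL x (c *: y + z) = conj c *: ipL x y + ipL x z.
Proof. by rewrite ipL_star ipLPl star_antilinear -!ipL_star. Qed.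

Lemma lact0r b : lact b (0 : P) = 0.
Proof. exact: (lin_0 (lact_linr b)). Qed.
Lemma ract0r x : ract x 0 = 0.
Proof. exact: (lin_0 (ract_linr x)). Qed.
Lemma ipR0r x : ipR x 0 = 0. Proof. exact: (lin_0 (ipR_lin x)). Qed.
Lemma ipR0l x : ipR 0 x = 0. Proof. by rewrite ipR_star ipR0r star0. Qed.

Lemma ipL0l x : ipL 0 x = 0. Proof. exact: (lin_0 (ipL_lin x)). Qed.
Lemma lact0l x : lact 0 x = 0. Proof. exact: (lin_0 (lact_linl x)). Qed.

Lemma ipRDl x y z : ipR (x + y) z = ipR x z + ipR y z.
Proof. by rewrite -[x]scale1r ipRPl conj1 !scale1r. Qed.
Lemma ipLDr x y z : ipL x (y + z) = ipL x y + ipL x z.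
Proof. by rewrite -[y]scale1r ipLPr conj1 !scale1r. Qed.
Lemma ipR_sumr I (r : seq I) x (G : I -> P) :
  ipR x (\sum_(i <- r) G i) = \sum_(i <- r) ipR x (G i).
Proof. exact: (lin_sum (ipR_lin x)). Qed.
Lemma ipR_suml I (r : seq I) x (G : I -> P) :
  ipR (\sum_(i <- r) G i) x = \sum_(i <- r) ipR (G i) x.
Proof. by rewrite ipR_star ipR_sumr star_sum; under eq_bigr do rewrite -ipR_star. Qed.
Lemma ipL_suml I (r : seq I) x (G : I -> P) :
  ipL (\sum_(i <- r) G i) x = \sum_(i <- r) ipL (G i) x.
Proof. exact: (lin_sum (ipL_lin x)). Qed.

Lemma ipR_ractl x y a : ipR (ract x a) y = star a * ipR x y.
Proof. by rewrite ipR_star ipR_ract starM -ipR_star. Qed.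
Lemma ipL_lactr x y b : ipL x (lact b y) = ipL x y * star b.
Proof. by rewrite ipL_star ipL_lact starM -ipL_star. Qed.

Lemma lact_faithful b : (forall x, lact b x = 0) -> b = 0.
Proof.
move=> b0; have [s e] := ipL_full P (1 : B).
rewrite -[b]mulr1 e mulr_sumr big1 // => p _.
by rewrite -saAr -ipL_lact b0 ipL0l scaler0.
Qed.

Lemma ract_faithful a : (forall x, ract x a = 0) -> a = 0.
Proof.
move=> a0; have [s e] := ipR_full P (1 : A).
rewrite -[a]mul1r e mulr_suml big1 // => p _.
by rewrite -saAl -ipR_ract a0 ipR0r scaler0.
Qed.

Lemma lact_inj b b' : (forall x, lact b x = lact b' x) -> b = b'.
Proof.
move=> e; apply/eqP; rewrite -subr_eq0 addrC -scaleN1r; apply/eqP.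
by apply: lact_faithful => x; rewrite lactPl e scaleN1r addNr.
Qed.

(* The two inner products have the same degeneracy space. *)
Lemma ipR_degen x : (forall y, ipR x y = 0) <-> (forall y, ipL x y = 0).
Proof.
split=> x0 y.
  rewrite ipL_star (_ : ipL y x = 0) ?star0 //; apply: lact_faithful => z.
  by rewrite ipLR x0 ract0r.
rewrite ipR_star (_ : ipR y x = 0) ?star0 // ipR_star.
rewrite (_ : ipR x y = 0) ?star0 //; apply: ract_faithful => z.
by rewrite -ipLR ipL_star x0 star0 lact0l.
Qed.

Lemma ipR_hact_r g x y :
  ipR x (hact g y) =
  \sum_(p <- sweedler g) ha_act p.2 (ipR (hact (star p.1) x) y).
Proof.
under eq_bigr => p _ do (rewrite ipR_hact;
  under eq_bigr => q _ do rewrite -hactA -starM).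
rewrite (@sweedlerA_mulS _ _ _ (fun u v => ipR (hact (star u) x) (hact v y))).
  by rewrite star1 hact1.
split=> [v|u] c u1 u2.
  by rewrite star_antilinear hactPl ipRPl conjK.
by rewrite hactPl ipRPr.
Qed.

Lemma ipL_bilin g x y :
  bilin (fun u v : H => ipL (hact u x) (hact (star (ho_antip v)) y)).
Proof.
split=> [v|u] c u1 u2; first by rewrite hactPl ipLPl.
by rewrite antipP star_antilinear hactPl ipLPr conjK.
Qed.

Section Compat.
Hypothesis ract_compat : forall g x a,
  hact g (ract x a) = \sum_(p <- sweedler g) ract (hact p.1 x) (ha_act p.2 a).

Lemma hact_lact_of_ract g b x :
  hact g (lact b x) = \sum_(p <- sweedler g) lact (ha_act p.1 b) (hact p.2 x).
Proof.
have [s ->] := ipL_full P b.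
have fL z : linear (fun w => \sum_(p <- sweedler g)
    lact (ha_act p.1 w) (hact p.2 z) : P).
  by apply: sum_linear => p c w w'; rewrite haPr lactPl.
rewrite (lin_sum (lact_linl x)) (lin_sum (hact_linr g)) (lin_sum (fL x)).
apply: eq_bigr => r _; rewrite (lin_Z (fL x)) (lin_Z (lact_linl x)).
rewrite (lin_Z (hact_linr g)); congr (_ *: _); set y := r.2.1; set z := r.2.2.
rewrite ipLR ract_compat.
under eq_bigr => p _ do rewrite ipR_hact (lin_sum (ract_linr _)).
under [RHS]eq_bigr => p _ do rewrite ipL_hact (lin_sum (lact_linl _)).
under [RHS]eq_bigr => p _ do under eq_bigr => q _ do rewrite ipLR.
rewrite (@sweedlerA _ _ _ (fun u v w => ract (hact u y)
  (ipR (hact (star (ho_antip v)) z) (hact w x)))) //.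
- by move=> v w c u u'; rewrite hactPl ractPl.
- by move=> u w c v v'; rewrite antipP star_antilinear hactPl ipRPl conjK ractPr.
- by move=> u v c w w'; rewrite hactPl ipRPr ractPr.
Qed.

End Compat.

End PreBimoduleTheory.

Section BimoduleTheory.
Variables (R : realDomainType) (H : hopfStarAlgebra R) (B A : hAlgebra H).
Variable E : bimodule B A.
Implicit Types (x y z : E) (a : A) (b : B) (g h : H) (c : cplx R).

Lemma ipR_inj x y : (forall z, ipR z x = ipR z y) -> x = y.
Proof.
move=> e; apply/eqP; rewrite -subr_eq0 addrC -scaleN1r; apply/eqP.
apply: ipR_nondeg => z; rewrite ipR_star ipRPr e scaleN1r addNr.
exact: star0.
Qed.

Lemma hact_ract g x a :
  hact g (ract x a) = \sum_(p <- sweedler g) ract (hact p.1 x) (ha_act p.2 a).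
Proof.
apply: ipR_inj => z; rewrite ipR_hact_r (lin_sum (ipR_lin z)).
under eq_bigr => p _ do rewrite ipR_ract ha_actM.
under [RHS]eq_bigr => p _ do rewrite ipR_ract ipR_hact_r mulr_suml.
rewrite -(@sweedlerA _ _ _ (fun u v w =>
  ha_act v (ipR (hact (star u) z) x) * ha_act w a)) //.
- move=> v w c u u'.
  by rewrite star_antilinear hactPl ipRPl conjK haPr saPl.
- by move=> u w c v v'; rewrite haPl saPl.
- by move=> u v c w w'; rewrite haPl saPr.
Qed.

Lemma hact_lact g b x :
  hact g (lact b x) = \sum_(p <- sweedler g) lact (ha_act p.1 b) (hact p.2 x).
Proof. exact/hact_lact_of_ract/hact_ract. Qed.

End BimoduleTheory.

(** ** The tensor product over B *)

Section TensorExt.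
Variables (K : pzRingType) (F E : lmodType K) (b : balancing F E).

Lemma tens_ext (M : zmodType) (f g : tensor b -> M) :
  {morph f : s t / s + t} -> {morph g : s t / s + t} ->
  (forall x y, f (tens b x y) = g (tens b x y)) -> f =1 g.
Proof.
move=> fD gD e; elim/tens_ind => [|//|s t IHs IHt].
  transitivity (0 : M); [|symmetry].
    by apply: (addrI (f 0)); rewrite -fD !addr0.
  by apply: (addrI (g 0)); rewrite -gD !addr0.
by rewrite fD gD IHs IHt.
Qed.

Lemma tlift_linear (M : lmodType K) (f : F -> E -> M) :
  balanced b f -> (forall y, linear (f ^~ y)) -> linear (@tlift K F E b M f).
Proof.
move=> fB fL c s t; rewrite (tliftD fB); congr (_ + _).
elim/tens_ind: s => [|x y|s u IHs IHu].
- by rewrite scaler0 !(tlift0 fB) scaler0.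
- by rewrite -tensZl !(tliftE fB) (lin_Z (fL y)).
- by rewrite scalerDr !(tliftD fB) scalerDr IHs IHu.
Qed.

Lemma tensPl c x x' y :
  tens b (c *: x + x') y = c *: tens b x y + tens b x' y.
Proof. by rewrite tensDl tensZl. Qed.

Lemma tens_suml I (r : seq I) (G : I -> F) y :
  tens b (\sum_(i <- r) G i) y = \sum_(i <- r) tens b (G i) y.
Proof. by apply: (lin_sum (f := (tens b)^~ y)) => c x x'; apply: tensPl. Qed.

Lemma tens_sumr I (r : seq I) x (G : I -> E) :
  tens b x (\sum_(i <- r) G i) = \sum_(i <- r) tens b x (G i).
Proof.
apply: (big_morph _ (tensDr b x)).
by apply: (addrI (tens b x 0)); rewrite -tensDr !addr0.
Qed.

End TensorExt.

Section BalancedTensor.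
Variables (R : realDomainType) (H : hopfStarAlgebra R) (D B A : hAlgebra H).
Variables (F : bimodule D B) (E : bimodule B A).
Local Notation C := (cplx R).
Implicit Types (x : E) (y : F) (a : A) (b : B) (d : D) (g h : H).

Fact alg_balancing_subproof (c : C) y b : ract (c *: y) b = c *: ract y b.
Proof. exact: (lin_Z (ract_linl b)). Qed.

Definition alg_balancing : balancing F E :=
  @Balancing C F E B (fun y b => ract y b) (fun b x => lact b x)
    alg_balancing_subproof.

Local Notation T := (tensor alg_balancing).
Local Notation "y ** x" := (tens alg_balancing y x)
  (at level 40, no associativity).
Implicit Types (s t : T).

Lemma tens_ract y b x : ract y b ** x = y ** lact b x.
Proof. exact: (@tens_bal _ _ _ alg_balancing). Qed.

Lemma tensZr c y x : y ** (c *: x) = c *: (y ** x).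
Proof.
rewrite -{1}[x]lact1 -(lin_Z (lact_linl x)) -tens_ract (lin_Z (ract_linr y)).
by rewrite ract1 tensZl.
Qed.

Lemma tensPr c y x x' : y ** (c *: x + x') = c *: (y ** x) + y ** x'.
Proof. by rewrite tensDr tensZr. Qed.

Definition T_lact d t : T := tlift (fun y x => lact d y ** x) t.
Definition T_ract t a : T := tlift (fun y x => y ** ract x a) t.
Definition T_hact g t : T :=
  tlift (fun y x => \sum_(p <- sweedler g) hact p.1 y ** hact p.2 x) t.
Definition T_ipR s t : A :=
  tlift (fun y x => tlift (fun y' x' => ipR x (lact (ipR y y') x')) t) s.
Definition T_ipL s t : D :=
  tlift (fun y x => tlift (fun y' x' => ipL (ract y (ipL x x')) y') t) s.

Lemma balancedI (M : lmodType C) (f : F -> E -> M) :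
  (forall x, linear (f ^~ x)) -> (forall y, {morph f y : x x' / x + x'}) ->
  (forall y b x, f (ract y b) x = f y (lact b x)) -> balanced alg_balancing f.
Proof. by move=> fl fr fb; split=> // x; apply: lin_D. Qed.

Lemma T_lact_lin d x : linear (fun y => lact d y ** x : T).
Proof. by move=> c y y'; rewrite lactPr tensPl. Qed.

Lemma T_lact_bal d : balanced alg_balancing (fun y x => lact d y ** x : T).
Proof.
apply: balancedI => [|y x x'|y b x]; first exact: T_lact_lin.
- exact: tensDr.
- by rewrite -lractA tens_ract.
Qed.

Lemma T_lactE d y x : T_lact d (y ** x) = lact d y ** x.
Proof. exact: (tliftE (T_lact_bal d)). Qed.

Lemma T_ract_lin a x : linear (fun y => y ** ract x a : T).
Proof. by move=> c y y'; rewrite tensPl. Qed.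

Lemma T_ract_bal a : balanced alg_balancing (fun y x => y ** ract x a : T).
Proof.
apply: balancedI => [|y x x'|y b x]; first exact: T_ract_lin.
- by rewrite (lin_D (ract_linl a)) tensDr.
- by rewrite tens_ract lractA.
Qed.

Lemma T_ractE a y x : T_ract (y ** x) a = y ** ract x a.
Proof. exact: (tliftE (T_ract_bal a)). Qed.

Lemma T_hact_bilin y x : bilin (fun u v : H => hact u y ** hact v x : T).
Proof.
split=> [v|u] c u1 u2; first by rewrite hactPl tensPl.
by rewrite hactPl tensPr.
Qed.

Lemma T_hact_lin g x :
  linear (fun y => \sum_(p <- sweedler g) hact p.1 y ** hact p.2 x : T).
Proof. by apply: sum_linear => p c y y'; rewrite hactPr tensPl. Qed.

Lemma T_hact_bal g : balanced alg_balancing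
  (fun y x => \sum_(p <- sweedler g) hact p.1 y ** hact p.2 x : T).
Proof.
apply: balancedI => [|y x x'|y b x]; first exact: T_hact_lin.
- rewrite -big_split /=; apply: eq_bigr => p _.
  by rewrite (lin_D (hact_linr _)) tensDr.
- under eq_bigr => p _ do (rewrite hact_ract tens_suml;
    under eq_bigr => q _ do rewrite tens_ract).
  under [RHS]eq_bigr => p _ do rewrite hact_lact tens_sumr.
  rewrite (@sweedlerA _ _ _
    (fun u v w => hact u y ** lact (ha_act v b) (hact w x) : T)) //.
  + by move=> v w c u u'; rewrite hactPl tensPl.
  + by move=> u w c v v'; rewrite haPl lactPl tensPr.
  + by move=> u v c w w'; rewrite hactPl lactPr tensPr.
Qed.

Lemma T_hactE g y x :
  T_hact g (y ** x) = \sum_(p <- sweedler g) hact p.1 y ** hact p.2 x.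
Proof. exact: (tliftE (T_hact_bal g)). Qed.

Lemma T_ipR_lin1 y x x' :
  linear (fun y' => ipR x (lact (ipR y y') x') : A).
Proof. by move=> c y1 y2; rewrite ipRPr lactPl ipRPr. Qed.

Lemma T_ipR_bal1 y x :
  balanced alg_balancing (fun y' x' => ipR x (lact (ipR y y') x') : A).
Proof.
apply: balancedI => [x'|y' x1 x2|y' b x']; first exact: T_ipR_lin1.
- by rewrite (lin_D (lact_linr _)) (lin_D (ipR_lin _)).
- by rewrite ipR_ract lactA.
Qed.

Lemma T_ipR_bal t : balanced alg_balancing (fun y x =>
  tlift (fun y' x' => ipR x (lact (ipR y y') x') : A) t).
Proof.
split=> [x y y'|y x x'|y b x].
- rewrite /tlift -big_split /=; apply: eq_bigr => p _.
  by rewrite ipRDl (lin_D (lact_linl _)) (lin_D (ipR_lin _)).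
- rewrite /tlift -big_split /=; apply: eq_bigr => p _.
  by rewrite ipRDl.
- rewrite /tlift /=; apply: eq_bigr => p _.
  by rewrite ipR_lact -lactA -ipR_ractl.
Qed.

Lemma T_ipRE y x y' x' :
  T_ipR (y ** x) (y' ** x') = ipR x (lact (ipR y y') x').
Proof. by rewrite /T_ipR (tliftE (T_ipR_bal _)) (tliftE (T_ipR_bal1 _ _)). Qed.

Lemma T_ipR_linear s : linear (T_ipR s).
Proof.
apply: sum_linear => p; apply: tlift_linear; first exact: T_ipR_bal1.
by move=> x'; apply: T_ipR_lin1.
Qed.

Lemma T_ipRDl t : {morph T_ipR^~ t : s s' / s + s'}.
Proof. exact: (tliftD (T_ipR_bal t)). Qed.

Lemma T_ipL_lin1 y x x' : {morph (fun y' => ipL (ract y (ipL x x')) y' : D) :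
  y1 y2 / y1 + y2}.
Proof. by move=> y1 y2; rewrite ipLDr. Qed.

Lemma T_ipL_bal1 y x :
  balanced alg_balancing (fun y' x' => ipL (ract y (ipL x x')) y' : D).
Proof.
split=> [x' y1 y2|y' x1 x2|y' b x'] /=; first exact: ipLDr.
- by rewrite ipLDr (lin_D (ract_linr _)) (lin_D (ipL_lin _)).
- by rewrite ipL_lactr ractA [RHS]ipL_ract starK.
Qed.

Lemma T_ipL_bal t : balanced alg_balancing (fun y x =>
  tlift (fun y' x' => ipL (ract y (ipL x x')) y' : D) t).
Proof.
split=> [x y y'|y x x'|y b x].
- rewrite /tlift -big_split /=; apply: eq_bigr => p _.
  by rewrite (lin_D (ract_linl _)) (lin_D (ipL_lin _)).
- rewrite /tlift -big_split /=; apply: eq_bigr => p _.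
  by rewrite (lin_D (ipL_lin _)) (lin_D (ract_linr _)) (lin_D (ipL_lin _)).
- rewrite /tlift /=; apply: eq_bigr => p _.
  by rewrite -ractA -ipL_lact.
Qed.

Lemma T_ipLE y x y' x' :
  T_ipL (y ** x) (y' ** x') = ipL (ract y (ipL x x')) y'.
Proof. by rewrite /T_ipL (tliftE (T_ipL_bal _)) (tliftE (T_ipL_bal1 _ _)). Qed.

Lemma T_ipL_linear t : linear (T_ipL^~ t).
Proof.
apply: tlift_linear; first exact: T_ipL_bal.
move=> x; apply: sum_linear => p c y y'.
by rewrite ractPl ipLPl.
Qed.

Lemma T_ipLDr s : {morph T_ipL s : t t' / t + t'}.
Proof.
move=> t t'; rewrite /T_ipL -big_split /=; apply: eq_bigr => p _.
exact: (tliftD (T_ipL_bal1 _ _)).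
Qed.

Lemma T_lact_linl t : linear (T_lact^~ t).
Proof. by apply: sum_linear => p c d d'; rewrite lactPl tensPl. Qed.
Lemma T_lact_linr d : linear (T_lact d).
Proof. by apply: tlift_linear; [apply: T_lact_bal | apply: T_lact_lin]. Qed.
Lemma T_ract_linl a : linear (T_ract^~ a).
Proof. by apply: tlift_linear; [apply: T_ract_bal | apply: T_ract_lin]. Qed.
Lemma T_ract_linr t : linear (T_ract t).
Proof. by apply: sum_linear => p c d d'; rewrite ractPr tensPr. Qed.
Lemma T_hact_linl t : linear (T_hact^~ t).
Proof.
by apply: sum_linear => p; apply: (sweedler_linear (T_hact_bilin _ _)).
Qed.
Lemma T_hact_linr g : linear (T_hact g).
Proof. by apply: tlift_linear; [apply: T_hact_bal | apply: T_hact_lin]. Qed.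

Fact addid : {morph (fun t : T => t) : s t / s + t}. Proof. by []. Qed.

Lemma T_lact1 t : T_lact 1 t = t.
Proof.
refine (tens_ext (f := T_lact 1) (g := id) (lin_D (T_lact_linr 1))
  addid _ t) => y x.
by rewrite T_lactE lact1.
Qed.

Lemma T_lactA d d' t : T_lact (d * d') t = T_lact d (T_lact d' t).
Proof.
refine (tens_ext (f := T_lact (d * d'))
  (g := fun t => T_lact d (T_lact d' t)) (lin_D (T_lact_linr _)) _ _ t) => [s s'|y x].
  by rewrite !(lin_D (T_lact_linr _)).
by rewrite !T_lactE lactA.
Qed.

Lemma T_ract1 t : T_ract t 1 = t.
Proof.
refine (tens_ext (f := T_ract^~ 1) (g := id) (lin_D (T_ract_linl 1)) addid _ t) => y x.
by rewrite T_ractE ract1.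
Qed.

Lemma T_ractA t a a' : T_ract t (a * a') = T_ract (T_ract t a) a'.
Proof.
refine (tens_ext (f := T_ract^~ (a * a'))
  (g := fun t => T_ract (T_ract t a) a') (lin_D (T_ract_linl _)) _ _ t) => [s s'|y x].
  by rewrite /= (lin_D (T_ract_linl a)) (lin_D (T_ract_linl a')).
by rewrite !T_ractE ractA.
Qed.

Lemma T_lractA d t a : T_ract (T_lact d t) a = T_lact d (T_ract t a).
Proof.
refine (tens_ext (f := fun t => T_ract (T_lact d t) a)
  (g := fun t => T_lact d (T_ract t a)) _ _ _ t) => [s s'|s s'|y x].
- by rewrite (lin_D (T_lact_linr d)) (lin_D (T_ract_linl a)).
- by rewrite (lin_D (T_ract_linl a)) (lin_D (T_lact_linr d)).
- by rewrite T_lactE !T_ractE T_lactE.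
Qed.

Lemma T_hact1 t : T_hact 1 t = t.
Proof.
refine (tens_ext (f := T_hact 1) (g := id) (lin_D (T_hact_linr 1)) addid _ t) => y x.
by rewrite T_hactE (sweedler1 (T_hact_bilin y x)) !hact1.
Qed.

Lemma T_hactA g h t : T_hact (g * h) t = T_hact g (T_hact h t).
Proof.
refine (tens_ext (f := T_hact (g * h))
  (g := fun t => T_hact g (T_hact h t)) (lin_D (T_hact_linr _)) _ _ t) => [s s'|y x].
  by rewrite !(lin_D (T_hact_linr _)).
rewrite !T_hactE (sweedlerM _ _ (T_hact_bilin y x)).
rewrite (lin_sum (T_hact_linr g)) exchange_big /=.
apply: eq_bigr => q _; rewrite T_hactE; apply: eq_bigr => p _.
by rewrite !hactA.
Qed.

Lemma T_ipR_ract s t a : T_ipR s (T_ract t a) = T_ipR s t * a.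
Proof.
refine (tens_ext (f := fun s => T_ipR s (T_ract t a))
  (g := fun s => T_ipR s t * a) (T_ipRDl _) _ _ s) => [s1 s2|y x].
  by rewrite T_ipRDl mulrDl.
refine (tens_ext (f := fun t => T_ipR (y ** x) (T_ract t a))
  (g := fun t => T_ipR (y ** x) t * a) _ _ _ t) => [t1 t2|t1 t2|y' x'].
- by rewrite (lin_D (T_ract_linl a)) (lin_D (T_ipR_linear _)).
- by rewrite (lin_D (T_ipR_linear _)) mulrDl.
- by rewrite T_ractE !T_ipRE -lractA ipR_ract.
Qed.

Lemma T_ipR_star s t : T_ipR s t = star (T_ipR t s).
Proof.
refine (tens_ext (f := T_ipR^~ t)
  (g := fun s => star (T_ipR t s)) (T_ipRDl _) _ _ s) => [s1 s2|y x].
  by rewrite (lin_D (T_ipR_linear _)) starD.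
refine (tens_ext (f := T_ipR (y ** x)) (g := fun t => star (T_ipR t (y ** x)))
  (lin_D (T_ipR_linear _)) _ _ t) => [t1 t2|y' x'].
  by rewrite T_ipRDl starD.
by rewrite !T_ipRE -ipR_star ipR_lact -ipR_star.
Qed.

Lemma T_ipR_full a : exists r : seq (C * (T * T)),
  a = \sum_(p <- r) p.1 *: T_ipR p.2.1 p.2.2.
Proof.
have [r ->] := ipR_full E a; have [q e] := ipR_full F (1 : B).
exists [seq (i.1 * j.1, (j.2.1 ** i.2.1, j.2.2 ** i.2.2)) | i <- r, j <- q].
rewrite big_allpairs_dep /=; apply: eq_bigr => i _.
under eq_bigr => j _ do rewrite T_ipRE -scalerA.
rewrite -scaler_sumr; congr (_ *: _).
rewrite -{1}[i.2.2]lact1 e (lin_sum (lact_linl _)) ipR_sumr.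
apply: eq_bigr => j _.
by rewrite (lin_Z (lact_linl _)) (lin_Z (ipR_lin _)).
Qed.

Lemma T_ipL_lact d s t : T_ipL (T_lact d s) t = d * T_ipL s t.
Proof.
refine (tens_ext (f := fun s => T_ipL (T_lact d s) t)
  (g := fun s => d * T_ipL s t) _ _ _ s) => [s1 s2|s1 s2|y x].
- by rewrite (lin_D (T_lact_linr d)) (lin_D (T_ipL_linear _)).
- by rewrite (lin_D (T_ipL_linear _)) mulrDr.
refine (tens_ext (f := T_ipL (T_lact d (y ** x)))
  (g := fun t => d * T_ipL (y ** x) t) (T_ipLDr _) _ _ t) => [t1 t2|y' x'].
  by rewrite T_ipLDr mulrDr.
by rewrite T_lactE !T_ipLE lractA ipL_lact.
Qed.

Lemma T_ipL_star s t : T_ipL s t = star (T_ipL t s).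
Proof.
refine (tens_ext (f := T_ipL^~ t)
  (g := fun s => star (T_ipL t s)) (lin_D (T_ipL_linear _)) _ _ s)
  => [s1 s2|y x].
  by rewrite T_ipLDr starD.
refine (tens_ext (f := T_ipL (y ** x)) (g := fun t => star (T_ipL t (y ** x)))
  (T_ipLDr _) _ _ t) => [t1 t2|y' x'].
  by rewrite (lin_D (T_ipL_linear _)) starD.
by rewrite !T_ipLE -ipL_star ipL_ract -ipL_star.
Qed.

Lemma T_ipL_full d : exists r : seq (C * (T * T)),
  d = \sum_(p <- r) p.1 *: T_ipL p.2.1 p.2.2.
Proof.
have [r ->] := ipL_full F d; have [q e] := ipL_full E (1 : B).
exists [seq (i.1 * j.1, (i.2.1 ** j.2.1, i.2.2 ** j.2.2)) | i <- r, j <- q].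
rewrite big_allpairs_dep /=; apply: eq_bigr => i _.
under eq_bigr => j _ do rewrite T_ipLE -scalerA.
rewrite -scaler_sumr; congr (_ *: _).
rewrite -{1}[i.2.1]ract1 e (lin_sum (ract_linr _)) ipL_suml.
apply: eq_bigr => j _.
by rewrite (lin_Z (ract_linr _)) (lin_Z (ipL_lin _)).
Qed.

Lemma T_ipR_lact d s t : T_ipR (T_lact d s) t = T_ipR s (T_lact (star d) t).
Proof.
refine (tens_ext (f := fun s => T_ipR (T_lact d s) t)
  (g := T_ipR^~ (T_lact (star d) t)) _ (T_ipRDl _) _ s) => [s1 s2|y x].
  by rewrite (lin_D (T_lact_linr d)) T_ipRDl.
refine (tens_ext (f := T_ipR (T_lact d (y ** x)))
  (g := fun t => T_ipR (y ** x) (T_lact (star d) t))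
  (lin_D (T_ipR_linear _)) _ _ t) => [t1 t2|y' x'].
  by rewrite (lin_D (T_lact_linr _)) (lin_D (T_ipR_linear _)).
by rewrite !T_lactE !T_ipRE ipR_lact.
Qed.

Lemma T_ipL_ract a s t : T_ipL (T_ract s a) t = T_ipL s (T_ract t (star a)).
Proof.
refine (tens_ext (f := fun s => T_ipL (T_ract s a) t)
  (g := T_ipL^~ (T_ract t (star a))) _ (lin_D (T_ipL_linear _)) _ s)
  => [s1 s2|y x].
  by rewrite (lin_D (T_ract_linl a)) (lin_D (T_ipL_linear _)).
refine (tens_ext (f := T_ipL (T_ract (y ** x) a))
  (g := fun t => T_ipL (y ** x) (T_ract t (star a)))
  (T_ipLDr _) _ _ t) => [t1 t2|y' x'].
  by rewrite (lin_D (T_ract_linl _)) T_ipLDr.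
by rewrite !T_ractE !T_ipLE (ipL_ract a).
Qed.

Lemma T_ipLR s t u : T_lact (T_ipL s t) u = T_ract s (T_ipR t u).
Proof.
refine (tens_ext (f := fun s => T_lact (T_ipL s t) u)
  (g := T_ract^~ (T_ipR t u)) _ (lin_D (T_ract_linl _)) _ s)
  => [s1 s2|y x].
  by rewrite (lin_D (T_ipL_linear _)) (lin_D (T_lact_linl _)).
refine (tens_ext (f := fun t => T_lact (T_ipL (y ** x) t) u)
  (g := fun t => T_ract (y ** x) (T_ipR t u)) _ _ _ t)
  => [t1 t2|t1 t2|y' x'].
- by rewrite T_ipLDr (lin_D (T_lact_linl _)).
- by rewrite T_ipRDl (lin_D (T_ract_linr _)).
refine (tens_ext (f := T_lact (T_ipL (y ** x) (y' ** x')))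
  (g := fun u => T_ract (y ** x) (T_ipR (y' ** x') u))
  (lin_D (T_lact_linr _)) _ _ u) => [u1 u2|y'' x''].
  by rewrite (lin_D (T_ipR_linear _)) (lin_D (T_ract_linr _)).
rewrite T_ipLE T_ipRE T_lactE T_ractE ipLR -ractA tens_ract.
by rewrite lactA ipLR.
Qed.

Lemma T_sumr (I : Type) (r : seq I) (G : I -> T) s :
  T_ipR s (\sum_(i <- r) G i) = \sum_(i <- r) T_ipR s (G i).
Proof. exact: (lin_sum (T_ipR_linear s)). Qed.

Lemma T_suml (I : Type) (r : seq I) (G : I -> T) s :
  T_ipR (\sum_(i <- r) G i) s = \sum_(i <- r) T_ipR (G i) s.
Proof. by rewrite T_ipR_star T_sumr star_sum; under eq_bigr do rewrite -T_ipR_star. Qed.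

Lemma T_ipR_hact_r g s t :
  T_ipR s (T_hact g t) =
  \sum_(p <- sweedler g) ha_act p.2 (T_ipR (T_hact (star p.1) s) t).
Proof.
refine (tens_ext (f := T_ipR^~ (T_hact g t))
  (g := fun s => \sum_(p <- sweedler g)
    ha_act p.2 (T_ipR (T_hact (star p.1) s) t)) (T_ipRDl _) _ _ s)
  => [s1 s2|y x].
  rewrite -big_split /=; apply: eq_bigr => p _.
  by rewrite (lin_D (T_hact_linr _)) T_ipRDl (lin_D (ha_actr _)).
refine (tens_ext (f := fun t => T_ipR (y ** x) (T_hact g t))
  (g := fun t => \sum_(p <- sweedler g)
    ha_act p.2 (T_ipR (T_hact (star p.1) (y ** x)) t)) _ _ _ t)
  => [t1 t2|t1 t2|y' x'].
- by rewrite (lin_D (T_hact_linr _)) (lin_D (T_ipR_linear _)).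
- rewrite -big_split /=; apply: eq_bigr => p _.
  by rewrite (lin_D (T_ipR_linear _)) (lin_D (ha_actr _)).
rewrite T_hactE T_sumr.
transitivity (\sum_(p <- sweedler g) \sum_(q <- sweedler p.1)
  ha_act p.2 (ipR (hact (star q.2) x)
    (lact (ipR (hact (star q.1) y) y') x'))); last first.
  apply: eq_bigr => p _; rewrite T_hactE.
  rewrite (sweedler_star _ (T_hact_bilin y x)) T_suml (lin_sum (ha_actr _)).
  by apply: eq_bigr => q _; rewrite T_ipRE.
rewrite (@sweedlerA _ _ _ (fun u v w => ha_act w (ipR (hact (star v) x)
    (lact (ipR (hact (star u) y) y') x')))); first last.
- by move=> u v c w w'; rewrite haPl.
- by move=> u w c v v'; rewrite star_antilinear hactPl ipRPl conjK haPr.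
- move=> v w c u u'.
  by rewrite star_antilinear hactPl ipRPl conjK lactPl ipRPr haPr.
under [RHS]eq_bigr => p _ do
  rewrite -ipR_hact_r hact_lact ipR_sumr.
rewrite -(@sweedlerA _ _ _ (fun u v w => ipR x
  (lact (ha_act v (ipR (hact (star u) y) y')) (hact w x')))); first last.
- by move=> u v c w w'; rewrite hactPl lactPr ipRPr.
- by move=> u w c v v'; rewrite haPl lactPl ipRPr.
- move=> v w c u u'.
  by rewrite star_antilinear hactPl ipRPl conjK haPr lactPl ipRPr.
apply: eq_bigr => p _; rewrite T_ipRE ipR_hact_r (lin_sum (lact_linl _)).
by rewrite ipR_sumr.
Qed.

Lemma T_ipR_hact g s t : ha_act g (T_ipR s t) =
  \sum_(p <- sweedler g) T_ipR (T_hact (star (ho_antip p.1)) s) (T_hact p.2 t).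
Proof.
under eq_bigr => p _ do (rewrite T_ipR_hact_r;
  under eq_bigr => q _ do rewrite -T_hactA -starM).
rewrite (@sweedlerA_Smul _ _ _
  (fun u v => ha_act v (T_ipR (T_hact (star u) s) t))).
  by rewrite star1 T_hact1.
split=> [v|u] c u1 u2; last by rewrite haPl.
rewrite star_antilinear T_hact_linl T_ipR_star T_ipR_linear star_antilinear.
by rewrite conjK -!T_ipR_star haPr.
Qed.

Lemma T_hact_lact g d t : T_hact g (T_lact d t) =
  \sum_(p <- sweedler g) T_lact (ha_act p.1 d) (T_hact p.2 t).
Proof.
refine (tens_ext (f := fun t => T_hact g (T_lact d t))
  (g := fun t => \sum_(p <- sweedler g) T_lact (ha_act p.1 d) (T_hact p.2 t))
  _ _ _ t) => [t1 t2|t1 t2|y x].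
- by rewrite (lin_D (T_lact_linr _)) (lin_D (T_hact_linr _)).
- rewrite -big_split /=; apply: eq_bigr => p _.
  by rewrite (lin_D (T_hact_linr _)) (lin_D (T_lact_linr _)).
rewrite T_lactE T_hactE.
under eq_bigr => p _ do rewrite hact_lact tens_suml.
under [RHS]eq_bigr => p _ do (rewrite T_hactE (lin_sum (T_lact_linr _));
  under eq_bigr => q _ do rewrite T_lactE).
rewrite (@sweedlerA _ _ _
  (fun u v w => lact (ha_act u d) (hact v y) ** hact w x : T)) //.
- by move=> v w c u u'; rewrite haPl lactPl tensPl.
- by move=> u w c v v'; rewrite hactPl lactPr tensPl.
- by move=> u v c w w'; rewrite hactPl tensPr.
Qed.

Lemma T_hact_ract g t a : T_hact g (T_ract t a) =
  \sum_(p <- sweedler g) T_ract (T_hact p.1 t) (ha_act p.2 a).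
Proof.
refine (tens_ext (f := fun t => T_hact g (T_ract t a))
  (g := fun t => \sum_(p <- sweedler g) T_ract (T_hact p.1 t) (ha_act p.2 a))
  _ _ _ t) => [t1 t2|t1 t2|y x].
- by rewrite (lin_D (T_ract_linl _)) (lin_D (T_hact_linr _)).
- rewrite -big_split /=; apply: eq_bigr => p _.
  by rewrite (lin_D (T_hact_linr _)) (lin_D (T_ract_linl _)).
rewrite T_ractE T_hactE.
under eq_bigr => p _ do rewrite hact_ract tens_sumr.
under [RHS]eq_bigr => p _ do (rewrite T_hactE (lin_sum (T_ract_linl _));
  under eq_bigr => q _ do rewrite T_ractE).
rewrite (@sweedlerA _ _ _
  (fun u v w => hact u y ** ract (hact v x) (ha_act w a) : T)) //.
- by move=> v w c u u'; rewrite hactPl tensPl.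
- by move=> u w c v v'; rewrite hactPl ractPl tensPr.
- by move=> u v c w w'; rewrite haPl ractPr tensPr.
Qed.

Lemma T_lact_faithful d : (forall t, T_lact d t = 0) -> d = 0.
Proof.
move=> d0; have [s e] := T_ipL_full 1.
rewrite -[d]mulr1 e mulr_sumr big1 // => p _.
by rewrite -saAr -T_ipL_lact d0 (lin_0 (T_ipL_linear _)) scaler0.
Qed.

Lemma T_ipL_hact g s t : ha_act g (T_ipL s t) =
  \sum_(p <- sweedler g) T_ipL (T_hact p.1 s) (T_hact (star (ho_antip p.2)) t).
Proof.
apply/eqP; rewrite -subr_eq0 addrC -scaleN1r; apply/eqP.
apply: T_lact_faithful => w; rewrite T_lact_linl.
apply/eqP; rewrite scaleN1r addrC subr_eq0; apply/eqP.
have bl1 : bilin (fun u v : H => T_lact (ha_act u (T_ipL s t)) (T_hact v w)).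
  split=> [v|u] c u1 u2; first by rewrite haPl T_lact_linl.
  by rewrite T_hact_linl T_lact_linr.
transitivity (\sum_(p <- sweedler g) T_hact p.1
    (T_lact (T_ipL s t) (T_hact (ho_antip p.2) w))).
  under [RHS]eq_bigr => p _ do (rewrite T_hact_lact;
    under eq_bigr => q _ do rewrite -T_hactA).
  by rewrite (sweedlerA_mulSr bl1) T_hact1.
rewrite (lin_sum (T_lact_linl w)).
under eq_bigr => p _ do (rewrite T_ipLR T_hact_ract;
  under eq_bigr => q _ do rewrite T_ipR_hact (lin_sum (T_ract_linr _))).
under [RHS]eq_bigr => p _ do rewrite T_ipLR.
pose G (u v w' z : H) := T_ract (T_hact u s)
  (T_ipR (T_hact (star (ho_antip v)) t) (T_hact w' (T_hact (ho_antip z) w))).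
have G1 v w' z : linear (fun u => G u v w' z).
  by move=> c u u'; rewrite /G T_hact_linl T_ract_linl.
have G2 u w' z : linear (fun v => G u v w' z).
  move=> c v v'; rewrite /G antipP star_antilinear T_hact_linl T_ipR_star.
  by rewrite T_ipR_linear star_antilinear conjK -!T_ipR_star T_ract_linr.
have G3 u v z : linear (fun w' => G u v w' z).
  by move=> c w1 w2; rewrite /G T_hact_linl T_ipR_linear T_ract_linr.
have G4 u v w' : linear (G u v w').
  move=> c z z'; rewrite /G antipP T_hact_linl T_hact_linr T_ipR_linear.
  exact: T_ract_linr.
have bG u z : bilin (fun v w' => G u v w' z).
  by split=> [w'|v]; [apply: G2 | apply: G3].
rewrite (@sweedlerA _ _ _
  (fun u v z => \sum_(r <- sweedler v) G u r.1 r.2 z)); first last.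
- by move=> u v; apply: sum_linear => r; apply: G4.
- by move=> u z; apply: (sweedler_linear (bG u z)).
- by move=> v z; apply: sum_linear => r; apply: G1.
apply: eq_bigr => p _; rewrite (@sweedlerA _ _ _ (G p.1)) //.
rewrite /G.
under eq_bigr => q _ do under eq_bigr => r _ do rewrite -T_hactA.
have bl2 : bilin (fun u v : H => T_ract (T_hact p.1 s)
    (T_ipR (T_hact (star (ho_antip u)) t) (T_hact v w))).
  split=> [v|u] c u1 u2.
    rewrite antipP star_antilinear T_hact_linl T_ipR_star T_ipR_linear.
    by rewrite star_antilinear conjK -!T_ipR_star T_ract_linr.
  by rewrite T_hact_linl T_ipR_linear T_ract_linr.
rewrite -(@sweedlerA _ _ _ (fun u v z => T_ract (T_hact p.1 s)
  (T_ipR (T_hact (star (ho_antip u)) t) (T_hact (v * ho_antip z) w)))).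
- by rewrite (sweedlerA_mulSr bl2) T_hact1.
- by move=> v z; apply: (bilinl bl2).
- by move=> u z c v v'; rewrite saPl (bilinr bl2).
- by move=> u v c z z'; rewrite antipP saPr (bilinr bl2).
Qed.

(* F (x)_B E with its two inner products, before the quotient by the
   degeneracy space. *)
Definition balanced_tensor : preBimodule D A := {|
  lact_linl := T_lact_linl; lact_linr := T_lact_linr; lact1 := T_lact1;
  lactA := T_lactA; ract_linl := T_ract_linl; ract_linr := T_ract_linr;
  ract1 := T_ract1; ractA := T_ractA; lractA := T_lractA;
  hact_linl := T_hact_linl; hact_linr := T_hact_linr; hact1 := T_hact1;
  hactA := T_hactA; ipR_lin := T_ipR_linear; ipR_ract := T_ipR_ract;
  ipR_star := T_ipR_star; ipR_full := T_ipR_full; ipL_lin := T_ipL_linear;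
  ipL_lact := T_ipL_lact; ipL_star := T_ipL_star; ipL_full := T_ipL_full;
  ipR_lact := T_ipR_lact; ipL_ract := T_ipL_ract; ipLR := T_ipLR;
  ipR_hact := T_ipR_hact; ipL_hact := T_ipL_hact |}.

End BalancedTensor.

(** ** The quotient by the degeneracy space *)

Section Nondegenerate.
Variables (R : realDomainType) (H : hopfStarAlgebra R) (B A : hAlgebra H).
Variable P : preBimodule B A.
Local Notation C := (cplx R).
Implicit Types (x y z : P) (a : A) (b : B) (g h : H) (c : C).

(* By [ipR_degen] the inner product ipL has the same degeneracy space. *)
Definition degen : {pred P} := fun x => `[< forall y, ipR x y = 0 >].

Lemma degenP x : reflect (forall y, ipR x y = 0) (x \in degen).
Proof. exact: asboolP. Qed.

Fact degen_linear c x y : x \in degen -> y \in degen -> c *: x + y \in degen.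
Proof.
move=> /degenP x0 /degenP y0; apply/degenP => z.
by rewrite ipRPl x0 y0 scaler0 addr0.
Qed.

Fact degen_zmod_closed : zmod_closed degen.
Proof.
split=> [|x y x0 y0]; first by apply/degenP => z; apply: ipR0l.
by rewrite addrC -scaleN1r degen_linear.
Qed.
HB.instance Definition _ := GRing.isZmodClosed.Build P degen degen_zmod_closed.

Definition degen_zmod : zmodClosed P := degen.

Definition nondeg := Quotient.quot degen_zmod.
HB.instance Definition _ := GRing.Zmodule.on nondeg.
Local Notation Q := nondeg.
Definition nd_pi (x : P) : Q := \pi_(Quotient.quot degen_zmod) x.
Local Notation pi := nd_pi.
Definition nd_repr (q : Q) : P := repr (q : Quotient.quot degen_zmod).

Lemma nd_reprK q : pi (nd_repr q) = q. Proof. exact: reprK. Qed.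

Lemma nd_piP x y : pi x = pi y <-> x - y \in degen.
Proof.
split=> [/eqP|h]; first by rewrite -Quotient.idealrBE.
by apply/eqP; rewrite -Quotient.idealrBE.
Qed.

Lemma nd_ind (K : Q -> Prop) : (forall x, K (pi x)) -> forall q, K q.
Proof. by move=> h q; rewrite -[q]nd_reprK; apply: h. Qed.

Lemma nd_piD x y : pi (x + y) = pi x + pi y.
Proof. exact: Quotient.pi_add. Qed.

Lemma nd_pi0 x : pi x = 0 <-> x \in degen.
Proof.
have <- : pi 0 = 0 by apply: (addrI (pi 0)); rewrite -nd_piD !addr0.
by have := nd_piP x 0; rewrite subr0.
Qed.

(* The map induced by an endomorphism of P that preserves degeneracy. *)
Definition nd_map (f : P -> P) (q : Q) : Q := pi (f (nd_repr q)).

Lemma nd_mapE (f : P -> P) x : linear f ->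
  (forall y, y \in degen -> f y \in degen) -> nd_map f (pi x) = pi (f x).
Proof.
move=> fL fd; apply/nd_piP.
rewrite addrC -scaleN1r -fL; apply: fd.
by rewrite scaleN1r addrC; apply/nd_piP/nd_reprK.
Qed.

Fact degenZ c x : x \in degen -> c *: x \in degen.
Proof.
by move=> h; rewrite -[_ *: _]addr0 degen_linear //; apply/degenP/ipR0l.
Qed.

Fact scale_linear c : linear (fun x : P => c *: x).
Proof. by move=> d x y; rewrite scalerDr !scalerA mulrC. Qed.

Definition nd_scale c q := nd_map (fun x => c *: x) q.

Lemma nd_scaleE c x : nd_scale c (pi x) = pi (c *: x).
Proof. exact: nd_mapE (scale_linear c) (@degenZ c). Qed.

Fact nd_scaleA c d q : nd_scale c (nd_scale d q) = nd_scale (c * d) q.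
Proof. by elim/nd_ind: q => x; rewrite !nd_scaleE scalerA. Qed.
Fact nd_scale1 : left_id 1 nd_scale.
Proof. by elim/nd_ind => x; rewrite nd_scaleE scale1r. Qed.
Fact nd_scaleDr : right_distributive nd_scale +%R.
Proof.
move=> c; elim/nd_ind => x; elim/nd_ind => y.
by rewrite !nd_scaleE -!nd_piD nd_scaleE scalerDr.
Qed.
Fact nd_scaleDl q : {morph nd_scale^~ q : c d / c + d}.
Proof. by move=> c d; elim/nd_ind: q => x; rewrite !nd_scaleE scalerDl nd_piD. Qed.

HB.instance Definition _ := GRing.Zmodule_isLmodule.Build C nondeg
  nd_scaleA nd_scale1 nd_scaleDr nd_scaleDl.

Lemma nd_pi_linear : linear pi.
Proof. by move=> c x y; rewrite nd_piD -nd_scaleE. Qed.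

Lemma nd_map_linear (f : P -> P) : linear f ->
  (forall y, y \in degen -> f y \in degen) -> linear (nd_map f).
Proof.
move=> fL fd c; elim/nd_ind => x; elim/nd_ind => y.
by rewrite -nd_pi_linear !(nd_mapE _ fL fd) fL nd_pi_linear.
Qed.

Lemma degen_lact b x : x \in degen -> lact b x \in degen.
Proof. by move=> /degenP x0; apply/degenP => y; rewrite ipR_lact. Qed.

Lemma degen_ract a x : x \in degen -> ract x a \in degen.
Proof. by move=> /degenP x0; apply/degenP => y; rewrite ipR_ractl x0 mulr0. Qed.

Lemma degen_hact g x : x \in degen -> hact g x \in degen.
Proof.
move=> /degenP x0; apply/degenP => y.
rewrite ipR_star ipR_hact_r big1 ?star0 // => p _.
by rewrite ipR_star x0 star0 ha_act0.
Qed.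

Definition nd_lact b q := nd_map (lact b) q.
Definition nd_ract q a := nd_map (ract^~ a) q.
Definition nd_hact g q := nd_map (hact g) q.
Definition nd_ipR q q' : A := ipR (nd_repr q) (nd_repr q').
Definition nd_ipL q q' : B := ipL (nd_repr q) (nd_repr q').

Lemma nd_lactE b x : nd_lact b (pi x) = pi (lact b x).
Proof. exact: nd_mapE (lact_linr b) (@degen_lact b). Qed.
Lemma nd_ractE a x : nd_ract (pi x) a = pi (ract x a).
Proof. exact: nd_mapE (ract_linl a) (@degen_ract a). Qed.
Lemma nd_hactE g x : nd_hact g (pi x) = pi (hact g x).
Proof. exact: nd_mapE (hact_linr g) (@degen_hact g). Qed.

Lemma nd_repr_pi x : exists2 d, d \in degen & nd_repr (pi x) = x + d.
Proof.
exists (nd_repr (pi x) - x); first exact/nd_piP/nd_reprK.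
by rewrite addrC subrK.
Qed.

Lemma nd_ipRE x y : nd_ipR (pi x) (pi y) = ipR x y.
Proof.
rewrite /nd_ipR; have [d /degenP d0 ->] := nd_repr_pi x.
have [e /degenP e0 ->] := nd_repr_pi y.
rewrite ipRDl d0 addr0 (lin_D (ipR_lin _)) [X in _ + X]ipR_star e0 star0.
by rewrite addr0.
Qed.

Lemma nd_ipLE x y : nd_ipL (pi x) (pi y) = ipL x y.
Proof.
rewrite /nd_ipL; have [d /degenP/ipR_degen d0 ->] := nd_repr_pi x.
have [e /degenP/ipR_degen e0 ->] := nd_repr_pi y.
rewrite ipLDr [X in _ + X]ipL_star e0 star0 addr0.
by rewrite (lin_D (ipL_lin _)) d0 addr0.
Qed.

Fact nd_lact_linl q : linear (nd_lact^~ q).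
Proof.
by elim/nd_ind: q => x c b b'; rewrite !nd_lactE lactPl nd_pi_linear.
Qed.
Fact nd_lact_linr b : linear (nd_lact b).
Proof. exact: nd_map_linear (lact_linr b) (@degen_lact b). Qed.
Fact nd_lact1 q : nd_lact 1 q = q.
Proof. by elim/nd_ind: q => x; rewrite nd_lactE lact1. Qed.
Fact nd_lactA b b' q : nd_lact (b * b') q = nd_lact b (nd_lact b' q).
Proof. by elim/nd_ind: q => x; rewrite !nd_lactE lactA. Qed.
Fact nd_ract_linl a : linear (nd_ract^~ a).
Proof. exact: nd_map_linear (ract_linl a) (@degen_ract a). Qed.
Fact nd_ract_linr q : linear (nd_ract q).
Proof.
by elim/nd_ind: q => x c a a'; rewrite !nd_ractE ractPr nd_pi_linear.
Qed.
Fact nd_ract1 q : nd_ract q 1 = q.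
Proof. by elim/nd_ind: q => x; rewrite nd_ractE ract1. Qed.
Fact nd_ractA q a a' : nd_ract q (a * a') = nd_ract (nd_ract q a) a'.
Proof. by elim/nd_ind: q => x; rewrite !nd_ractE ractA. Qed.
Fact nd_lractA b q a : nd_ract (nd_lact b q) a = nd_lact b (nd_ract q a).
Proof. by elim/nd_ind: q => x; rewrite nd_lactE !nd_ractE nd_lactE lractA. Qed.
Fact nd_hact_linl q : linear (nd_hact^~ q).
Proof.
by elim/nd_ind: q => x c g h; rewrite !nd_hactE hactPl nd_pi_linear.
Qed.
Fact nd_hact_linr g : linear (nd_hact g).
Proof. exact: nd_map_linear (hact_linr g) (@degen_hact g). Qed.
Fact nd_hact1 q : nd_hact 1 q = q.
Proof. by elim/nd_ind: q => x; rewrite nd_hactE hact1. Qed.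
Fact nd_hactA g h q : nd_hact (g * h) q = nd_hact g (nd_hact h q).
Proof. by elim/nd_ind: q => x; rewrite !nd_hactE hactA. Qed.
Fact nd_ipR_lin q : linear (nd_ipR q).
Proof.
elim/nd_ind: q => x c; elim/nd_ind => y; elim/nd_ind => z.
by rewrite -nd_pi_linear !nd_ipRE ipRPr.
Qed.
Fact nd_ipR_ract q q' a : nd_ipR q (nd_ract q' a) = nd_ipR q q' * a.
Proof.
by elim/nd_ind: q => x; elim/nd_ind: q' => y; rewrite nd_ractE !nd_ipRE ipR_ract.
Qed.
Fact nd_ipR_star q q' : nd_ipR q q' = star (nd_ipR q' q).
Proof. exact: ipR_star. Qed.
Fact nd_ipR_full a : exists s : seq (C * (Q * Q)),
  a = \sum_(p <- s) p.1 *: nd_ipR p.2.1 p.2.2.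
Proof.
have [s ->] := ipR_full P a.
exists [seq (p.1, (pi p.2.1, pi p.2.2)) | p <- s].
by rewrite big_map; apply: eq_bigr => p _; rewrite nd_ipRE.
Qed.
Fact nd_ipL_lin q : linear (nd_ipL^~ q).
Proof.
elim/nd_ind: q => x c; elim/nd_ind => y; elim/nd_ind => z.
by rewrite -nd_pi_linear !nd_ipLE ipLPl.
Qed.
Fact nd_ipL_lact b q q' : nd_ipL (nd_lact b q) q' = b * nd_ipL q q'.
Proof.
by elim/nd_ind: q => x; elim/nd_ind: q' => y; rewrite nd_lactE !nd_ipLE ipL_lact.
Qed.
Fact nd_ipL_star q q' : nd_ipL q q' = star (nd_ipL q' q).
Proof. exact: ipL_star. Qed.
Fact nd_ipL_full b : exists s : seq (C * (Q * Q)),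
  b = \sum_(p <- s) p.1 *: nd_ipL p.2.1 p.2.2.
Proof.
have [s ->] := ipL_full P b.
exists [seq (p.1, (pi p.2.1, pi p.2.2)) | p <- s].
by rewrite big_map; apply: eq_bigr => p _; rewrite nd_ipLE.
Qed.
Fact nd_ipR_lact b q q' :
  nd_ipR (nd_lact b q) q' = nd_ipR q (nd_lact (star b) q').
Proof.
by elim/nd_ind: q => x; elim/nd_ind: q' => y;
  rewrite !nd_lactE !nd_ipRE ipR_lact.
Qed.
Fact nd_ipL_ract a q q' :
  nd_ipL (nd_ract q a) q' = nd_ipL q (nd_ract q' (star a)).
Proof.
by elim/nd_ind: q => x; elim/nd_ind: q' => y;
  rewrite !nd_ractE !nd_ipLE ipL_ract.
Qed.
Fact nd_ipLR q q' q'' : nd_lact (nd_ipL q q') q'' = nd_ract q (nd_ipR q' q'').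
Proof.
elim/nd_ind: q => x; elim/nd_ind: q' => y; elim/nd_ind: q'' => z.
by rewrite nd_ipLE nd_ipRE nd_lactE nd_ractE ipLR.
Qed.
Fact nd_ipR_hact g q q' : ha_act g (nd_ipR q q') = \sum_(p <- sweedler g)
  nd_ipR (nd_hact (star (ho_antip p.1)) q) (nd_hact p.2 q').
Proof.
elim/nd_ind: q => x; elim/nd_ind: q' => y; rewrite nd_ipRE ipR_hact.
by apply: eq_bigr => p _; rewrite !nd_hactE nd_ipRE.
Qed.
Fact nd_ipL_hact g q q' : ha_act g (nd_ipL q q') = \sum_(p <- sweedler g)
  nd_ipL (nd_hact p.1 q) (nd_hact (star (ho_antip p.2)) q').
Proof.
elim/nd_ind: q => x; elim/nd_ind: q' => y; rewrite nd_ipLE ipL_hact.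
by apply: eq_bigr => p _; rewrite !nd_hactE nd_ipLE.
Qed.

Definition nondeg_pre : preBimodule B A := {|
  lact_linl := nd_lact_linl; lact_linr := nd_lact_linr; lact1 := nd_lact1;
  lactA := nd_lactA; ract_linl := nd_ract_linl; ract_linr := nd_ract_linr;
  ract1 := nd_ract1; ractA := nd_ractA; lractA := nd_lractA;
  hact_linl := nd_hact_linl; hact_linr := nd_hact_linr; hact1 := nd_hact1;
  hactA := nd_hactA; ipR_lin := nd_ipR_lin; ipR_ract := nd_ipR_ract;
  ipR_star := nd_ipR_star; ipR_full := nd_ipR_full; ipL_lin := nd_ipL_lin;
  ipL_lact := nd_ipL_lact; ipL_star := nd_ipL_star; ipL_full := nd_ipL_full;
  ipR_lact := nd_ipR_lact; ipL_ract := nd_ipL_ract; ipLR := nd_ipLR;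
  ipR_hact := nd_ipR_hact; ipL_hact := nd_ipL_hact |}.

Fact nd_ipR_nondeg (q : nondeg_pre) : (forall q', ipR q q' = 0) -> q = 0.
Proof.
elim/nd_ind: q => x x0; apply/nd_pi0/degenP => y.
by rewrite -nd_ipRE; apply: x0.
Qed.

Fact nd_ipL_nondeg (q : nondeg_pre) : (forall q', ipL q q' = 0) -> q = 0.
Proof. by move=> q0; apply/nd_ipR_nondeg/ipR_degen. Qed.

Definition nondeg_quotient : bimodule B A :=
  Bimodule nd_ipR_nondeg nd_ipL_nondeg.

End Nondegenerate.

(* F (~x)_B E *)
Definition btensor (R : realDomainType) (H : hopfStarAlgebra R)
    (D B A : hAlgebra H) (F : bimodule D B) (E : bimodule B A) :
    bimodule D A :=
  nondeg_quotient (balanced_tensor F E).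

(** * The Picard groupoid *)

Section Canonical.
Variables (R : realDomainType) (H : hopfStarAlgebra R) (A : hAlgebra H).
Local Notation C := (cplx R).
Implicit Types (x y z a b : A) (g h : H).

Definition id_ipR x y : A := star x * y.
Definition id_ipL x y : A := x * star y.

Fact id_lact_linl y : linear ( *%R^~ y : A -> A).
Proof. by move=> c x x'; rewrite saPl. Qed.
Fact id_lact_linr x : linear ( *%R x : A -> A).
Proof. by move=> c y y'; rewrite saPr. Qed.
Fact id_lact1 x : 1 * x = x. Proof. exact: mul1r. Qed.
Fact id_lactA x y z : x * y * z = x * (y * z). Proof. by rewrite mulrA. Qed.
Fact id_ract1 x : x * 1 = x. Proof. exact: mulr1. Qed.
Fact id_ractA x y z : x * (y * z) = x * y * z. Proof. exact: mulrA. Qed.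
Fact id_ipR_lin x : linear (id_ipR x). Proof. exact: id_lact_linr. Qed.
Fact id_ipR_ract x y a : id_ipR x (y * a) = id_ipR x y * a.
Proof. exact: mulrA. Qed.
Fact id_ipR_star x y : id_ipR x y = star (id_ipR y x).
Proof. by rewrite /id_ipR starM starK. Qed.
Fact id_ipR_full a : exists s : seq (C * (A * A)),
  a = \sum_(p <- s) p.1 *: id_ipR p.2.1 p.2.2.
Proof.
exists [:: (1, (1, a))].
by rewrite big_seq1 /= scale1r /id_ipR star1 mul1r.
Qed.
Fact id_ipL_lin y : linear (id_ipL^~ y). Proof. exact: id_lact_linl. Qed.
Fact id_ipL_lact b x y : id_ipL (b * x) y = b * id_ipL x y.
Proof. by rewrite /id_ipL mulrA. Qed.
Fact id_ipL_star x y : id_ipL x y = star (id_ipL y x).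
Proof. by rewrite /id_ipL starM starK. Qed.
Fact id_ipL_full a : exists s : seq (C * (A * A)),
  a = \sum_(p <- s) p.1 *: id_ipL p.2.1 p.2.2.
Proof.
exists [:: (1, (a, 1))].
by rewrite big_seq1 /= scale1r /id_ipL star1 mulr1.
Qed.
Fact id_ipR_lact b x y : id_ipR (b * x) y = id_ipR x (star b * y).
Proof. by rewrite /id_ipR starM mulrA. Qed.
Fact id_ipL_ract a x y : id_ipL (x * a) y = id_ipL x (y * star a).
Proof. by rewrite /id_ipL starM starK mulrA. Qed.
Fact id_ipLR x y z : id_ipL x y * z = x * id_ipR y z.
Proof. by rewrite /id_ipL /id_ipR mulrA. Qed.

Fact ha_act_antip g x : star (ha_act (star (ho_antip g)) x) = ha_act g (star x).
Proof. by rewrite ha_act_star ho_antip_star. Qed.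

Fact id_ipR_hact g x y : ha_act g (id_ipR x y) = \sum_(p <- sweedler g)
  id_ipR (ha_act (star (ho_antip p.1)) x) (ha_act p.2 y).
Proof.
by rewrite ha_actM; apply: eq_bigr => p _; rewrite /id_ipR ha_act_antip.
Qed.
Fact id_ipL_hact g x y : ha_act g (id_ipL x y) = \sum_(p <- sweedler g)
  id_ipL (ha_act p.1 x) (ha_act (star (ho_antip p.2)) y).
Proof.
by rewrite ha_actM; apply: eq_bigr => p _; rewrite /id_ipL ha_act_antip.
Qed.

Definition id_pre : preBimodule A A := {|
  lact_linl := id_lact_linl; lact_linr := id_lact_linr; lact1 := id_lact1;
  lactA := id_lactA; ract_linl := id_lact_linl; ract_linr := id_lact_linr;
  ract1 := id_ract1; ractA := id_ractA; lractA := id_lactA;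
  hact_linl := @ha_actl R H A; hact_linr := @ha_actr R H A;
  hact1 := @ha_act1 R H A; hactA := @ha_actA R H A;
  ipR_lin := id_ipR_lin; ipR_ract := id_ipR_ract; ipR_star := id_ipR_star;
  ipR_full := id_ipR_full; ipL_lin := id_ipL_lin; ipL_lact := id_ipL_lact;
  ipL_star := id_ipL_star; ipL_full := id_ipL_full; ipR_lact := id_ipR_lact;
  ipL_ract := id_ipL_ract; ipLR := id_ipLR; ipR_hact := id_ipR_hact;
  ipL_hact := id_ipL_hact |}.

Fact id_ipR_nondeg (x : id_pre) : (forall y, ipR x y = 0) -> x = 0.
Proof.
move=> /(_ (1 : A)); rewrite -[ipR _ _]/(star (x : A) * 1) mulr1 => e.
by rewrite -[x]starK e star0.
Qed.
Fact id_ipL_nondeg (x : id_pre) : (forall y, ipL x y = 0) -> x = 0.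
Proof.
by move=> /(_ (1 : A)); rewrite -[ipL _ _]/((x : A) * star 1) star1 mulr1.
Qed.

Definition id_bimodule : bimodule A A := Bimodule id_ipR_nondeg id_ipL_nondeg.

End Canonical.

Record bimodule_iso (R : realDomainType) (H : hopfStarAlgebra R)
    (B A : hAlgebra H) (E E' : bimodule B A) (f : E -> E') : Prop :=
  BimoduleIso {
  iso_bij : bijective f;
  iso_linear : linear f;
  iso_lact : forall b x, f (lact b x) = lact b (f x);
  iso_ract : forall x a, f (ract x a) = ract (f x) a;
  iso_hact : forall g x, f (hact g x) = hact g (f x);
  iso_ipL : forall x y, ipL (f x) (f y) = ipL x y;
  iso_ipR : forall x y, ipR (f x) (f y) = ipR x y }.

Definition isomorphic (R : realDomainType) (H : hopfStarAlgebra R)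
    (B A : hAlgebra H) (E E' : bimodule B A) : Prop :=
  exists f : E -> E', bimodule_iso f.

Section Isomorphic.
Variables (R : realDomainType) (H : hopfStarAlgebra R) (B A : hAlgebra H).
Implicit Types E : bimodule B A.

Lemma isomorphic_refl E : isomorphic E E.
Proof. by exists id; split=> //; exists id. Qed.

Lemma isomorphic_sym E E' : isomorphic E E' -> isomorphic E' E.
Proof.
case=> f [[f' fK f'K] fl fb fa fh fL fR]; exists f'; split.
- by exists f.
- by move=> c x y; apply: (can_inj fK); rewrite fl !f'K.
- by move=> b x; apply: (can_inj fK); rewrite fb !f'K.
- by move=> a x; apply: (can_inj fK); rewrite fa !f'K.
- by move=> g x; apply: (can_inj fK); rewrite fh !f'K.
- by move=> x y; rewrite -fL !f'K.
- by move=> x y; rewrite -fR !f'K.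
Qed.

Lemma isomorphic_trans E E' E'' :
  isomorphic E E' -> isomorphic E' E'' -> isomorphic E E''.
Proof.
case=> f [bf fl fb fa fh fL fR] [k [bk kl kb ka kh kL kR]].
exists (k \o f); split=> [|c x y|b x|x a|g x|x y|x y] /=.
- exact: bij_comp.
- by rewrite fl kl.
- by rewrite fb kb.
- by rewrite fa ka.
- by rewrite fh kh.
- by rewrite kL fL.
- by rewrite kR fR.
Qed.

(* An element of Pic is an isomorphism class of bimodules. *)
Record pic := Pic_of {
  pic_class :> bimodule B A -> Prop;
  pic_classP : exists E, pic_class = isomorphic E }.

Definition pic_cl E : pic := Pic_of (ex_intro _ E (erefl (isomorphic E))).

Lemma pic_eq (c d : pic) : (forall E, c E <-> d E) -> c = d.
Proof.
case: c d => c cP [d dP] /= e.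
have {}e : c = d by apply/funext => E; apply/propext.
by case: d / e dP => dP; rewrite (Prop_irrelevance cP dP).
Qed.

Lemma pic_clP E E' : pic_cl E = pic_cl E' <-> isomorphic E E'.
Proof.
split=> [e|i].
  have : pic_cl E E by apply: isomorphic_refl.
  by rewrite e => /isomorphic_sym.
apply: pic_eq => G /=; split; apply: isomorphic_trans => //.
exact: isomorphic_sym.
Qed.

End Isomorphic.

Section TensorIso.
Variables (R : realDomainType) (H : hopfStarAlgebra R) (D B A : hAlgebra H).
Variables (F F' : bimodule D B) (E E' : bimodule B A).
Variables (f : F -> F') (e : E -> E').
Hypotheses (fI : bimodule_iso f) (eI : bimodule_iso e).
Local Notation T := (balanced_tensor F E).
Local Notation T' := (balanced_tensor F' E').
Local Notation "y ** x" := (tens (alg_balancing F E) y x : T)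
  (at level 40, no associativity).
Local Notation "y **' x" := (tens (alg_balancing F' E') y x : T')
  (at level 40, no associativity).

Let phi0 (t : T) : T' := tlift (fun y x => f y **' e x) t.

Fact tensor_iso_bal :
  balanced (alg_balancing F E) (fun y x => f y **' e x).
Proof.
apply: balancedI => [x c y y'|y x x'|y b x].
- by rewrite (iso_linear fI) tensPl.
- by rewrite (lin_D (iso_linear eI)) tensDr.
- by rewrite (iso_ract fI) tens_ract (iso_lact eI).
Qed.

Fact phi0E y x : phi0 (y ** x) = f y **' e x.
Proof. exact: (tliftE tensor_iso_bal). Qed.

Fact phi0_linear : linear phi0.
Proof.
apply: (tlift_linear tensor_iso_bal) => x c y y'.
by rewrite (iso_linear fI) tensPl.
Qed.

Let phi0D := lin_D phi0_linear.

Fact phi0_ipR s t : ipR (phi0 s) (phi0 t) = ipR s t.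
Proof.
refine (tens_ext (f := fun s => ipR (phi0 s) (phi0 t)) (g := fun s : T => ipR s t)
  _ (fun s1 s2 : T => ipRDl s1 s2 t) _ s) => [s1 s2|y x].
  by rewrite phi0D ipRDl.
refine (tens_ext (f := fun t => ipR (phi0 (y ** x)) (phi0 t))
  (g := ipR (y ** x)) _ (lin_D (ipR_lin (y ** x))) _ t) => [t1 t2|y' x'].
  by rewrite phi0D (lin_D (ipR_lin _)).
rewrite !phi0E; rewrite -[LHS]/(T_ipR _ _) -[RHS]/(T_ipR _ _) !T_ipRE.
by rewrite (iso_ipR fI) -(iso_lact eI) (iso_ipR eI).
Qed.

Fact phi0_ipL s t : ipL (phi0 s) (phi0 t) = ipL s t.
Proof.
refine (tens_ext (f := fun s => ipL (phi0 s) (phi0 t)) (g := fun s : T => ipL s t)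
  _ (lin_D (ipL_lin t)) _ s) => [s1 s2|y x].
  by rewrite phi0D (lin_D (ipL_lin _)).
refine (tens_ext (f := fun t => ipL (phi0 (y ** x)) (phi0 t))
  (g := ipL (y ** x)) _ (ipLDr (y ** x)) _ t) => [t1 t2|y' x'].
  by rewrite phi0D ipLDr.
rewrite !phi0E; rewrite -[LHS]/(T_ipL _ _) -[RHS]/(T_ipL _ _) !T_ipLE.
by rewrite (iso_ipL eI) -(iso_ract fI) (iso_ipL fI).
Qed.

Fact phi0_lact d t : phi0 (lact d t) = lact d (phi0 t).
Proof.
refine (tens_ext (f := fun t : T => phi0 (lact d t))
  (g := fun t => lact d (phi0 t)) _ _ _ t) => [t1 t2|t1 t2|y x].
- by rewrite (lin_D (lact_linr d)) phi0D.
- by rewrite phi0D (lin_D (lact_linr d)).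
rewrite phi0E -[lact d (_ ** _)]/(T_lact d _) -[RHS]/(T_lact d _).
by rewrite !T_lactE [LHS]phi0E (iso_lact fI).
Qed.

Fact phi0_ract t a : phi0 (ract t a) = ract (phi0 t) a.
Proof.
refine (tens_ext (f := fun t : T => phi0 (ract t a))
  (g := fun t => ract (phi0 t) a) _ _ _ t) => [t1 t2|t1 t2|y x].
- by rewrite (lin_D (ract_linl a)) phi0D.
- by rewrite phi0D (lin_D (ract_linl a)).
rewrite phi0E -[ract (_ ** _) a]/(T_ract _ a) -[RHS]/(T_ract _ a).
by rewrite !T_ractE [LHS]phi0E (iso_ract eI).
Qed.

Fact phi0_hact g t : phi0 (hact g t) = hact g (phi0 t).
Proof.
refine (tens_ext (f := fun t : T => phi0 (hact g t))
  (g := fun t => hact g (phi0 t)) _ _ _ t) => [t1 t2|t1 t2|y x].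
- by rewrite (lin_D (hact_linr g)) phi0D.
- by rewrite phi0D (lin_D (hact_linr g)).
rewrite phi0E -[hact g (_ ** _)]/(T_hact g _) -[RHS]/(T_hact g _).
rewrite !T_hactE [LHS](lin_sum phi0_linear); apply: eq_bigr => p _.
by rewrite [LHS]phi0E (iso_hact fI) (iso_hact eI).
Qed.

Fact phi0_surj t : exists s, phi0 s = t.
Proof.
elim/tens_ind: t => [|y x|t1 t2 [s1 <-] [s2 <-]].
- by exists 0; apply: (lin_0 phi0_linear).
- have [f' _ fK] := iso_bij fI; have [e' _ eK] := iso_bij eI.
  by exists (f' y ** e' x); rewrite phi0E fK eK.
- by exists (s1 + s2); rewrite phi0D.
Qed.

Let phi (q : btensor F E) : btensor F' E' := nd_pi (phi0 (nd_repr q)).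

Fact phiE t : phi (nd_pi t) = nd_pi (phi0 t).
Proof.
have [d /degenP d0 e0] := nd_repr_pi t.
rewrite /phi e0 phi0D nd_piD (_ : nd_pi (phi0 d) = 0) ?addr0 //.
apply/nd_pi0/degenP => t'; have [s <-] := phi0_surj t'.
by rewrite phi0_ipR d0.
Qed.

Fact phi_ipR q q' : ipR (phi q) (phi q') = ipR q q'.
Proof.
elim/nd_ind: q => s; elim/nd_ind: q' => t; rewrite !phiE.
by rewrite -[LHS]/(nd_ipR _ _) -[RHS]/(nd_ipR _ _) !nd_ipRE phi0_ipR.
Qed.

Fact phi_iso : bimodule_iso phi.
Proof.
have inj : injective phi.
  move=> q q' eq; apply: ipR_inj => z.
  by rewrite -phi_ipR eq phi_ipR.
have surj q' : exists q, phi q = q'.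
  elim/nd_ind: q' => t; have [s <-] := phi0_surj t.
  by exists (nd_pi s); rewrite phiE.
have [k kK] := choice surj.
split.
- by exists k => // q; apply: inj.
- move=> c; elim/nd_ind => s; elim/nd_ind => t.
  by rewrite -nd_pi_linear !phiE phi0_linear nd_pi_linear.
- move=> d; elim/nd_ind => t.
  change (phi (nd_lact d (nd_pi t)) = nd_lact d (phi (nd_pi t))).
  by rewrite phiE !nd_lactE phiE phi0_lact.
- elim/nd_ind => t a.
  change (phi (nd_ract (nd_pi t) a) = nd_ract (phi (nd_pi t)) a).
  by rewrite phiE !nd_ractE phiE phi0_ract.
- move=> g; elim/nd_ind => t.
  change (phi (nd_hact g (nd_pi t)) = nd_hact g (phi (nd_pi t))).
  by rewrite phiE !nd_hactE phiE phi0_hact.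
- elim/nd_ind => s; elim/nd_ind => t; rewrite !phiE.
  by rewrite -[LHS]/(nd_ipL _ _) -[RHS]/(nd_ipL _ _) !nd_ipLE phi0_ipL.
- exact: phi_ipR.
Qed.

End TensorIso.

Section PicComp.
Variables (R : realDomainType) (H : hopfStarAlgebra R) (D B A : hAlgebra H).

Lemma btensor_isomorphic (F F' : bimodule D B) (E E' : bimodule B A) :
  isomorphic F F' -> isomorphic E E' ->
  isomorphic (btensor F E) (btensor F' E').
Proof. by case=> f fI [e eI]; eexists; apply: phi_iso fI eI. Qed.

Definition pic_comp_class (c : pic D B) (d : pic B A) (G : bimodule D A) :=
  exists F E, [/\ c F, d E & isomorphic (btensor F E) G].

Lemma pic_comp_classE (F : bimodule D B) (E : bimodule B A) :
  pic_comp_class (pic_cl F) (pic_cl E) = isomorphic (btensor F E).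
Proof.
apply/funext => G; apply/propext; split=> [[F' [E' [iF iE]]]|i].
  exact/isomorphic_trans/btensor_isomorphic.
by exists F, E; split=> //; apply: isomorphic_refl.
Qed.

Fact pic_comp_subproof (c : pic D B) (d : pic B A) :
  exists G, pic_comp_class c d = isomorphic G.
Proof.
have [F eF] := pic_classP c; have [E eE] := pic_classP d.
exists (btensor F E); rewrite -pic_comp_classE /pic_comp_class.
by rewrite eF eE.
Qed.

Definition pic_comp (c : pic D B) (d : pic B A) : pic D A :=
  Pic_of (pic_comp_subproof c d).

Lemma pic_compE (F : bimodule D B) (E : bimodule B A) :
  pic_comp (pic_cl F) (pic_cl E) = pic_cl (btensor F E).
Proof. by apply: pic_eq => G /=; rewrite pic_comp_classE. Qed.

End PicComp.

(** * Central elements *)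

Definition central (R : realDomainType) (A : starAlgebra R) (a : A) : Prop :=
  forall a', a * a' = a' * a.

Definition inv_central (R : realDomainType) (H : hopfStarAlgebra R)
    (A : hAlgebra H) (a : A) : Prop :=
  central a /\ forall g, ha_act g a = ho_eps g *: a.

Definition ZH (R : realDomainType) (H : hopfStarAlgebra R) (A : hAlgebra H) :=
  {a : A | inv_central a}.

(* [f] restricts to a star-isomorphism from [P] to [Q]. *)
Record star_iso_on (R : realDomainType) (A B : starAlgebra R)
    (P : A -> Prop) (Q : B -> Prop) (f : A -> B) : Prop := StarIsoOn {
  siso_fun : forall a, P a -> Q (f a);
  siso_inj : forall a a', P a -> P a' -> f a = f a' -> a = a';
  siso_surj : forall b, Q b -> exists2 a, P a & f a = b;
  siso_linear : forall c a a', P a -> P a' -> f (c *: a + a') = c *: f a + f a';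
  siso_mul : forall a a', P a -> P a' -> f (a * a') = f a * f a';
  siso_one : f 1 = 1;
  siso_star : forall a, P a -> f (star a) = star (f a) }.

(* The element h_E(a) of Z(B), for a in Z(A). *)
Definition hmap (R : realDomainType) (H : hopfStarAlgebra R)
    (B A : hAlgebra H) (E : bimodule B A) (a : A) : B :=
  xget 0 (fun b : B => central b /\ forall x : E, lact b x = ract x a).

(* Main.v *)
(* As 1 is a finite sum of values of the left inner product, say of terms
   c_i <x_i, y_i>, the element h_E(a) is the sum of the c_i <x_i . a, y_i>.
   Exchanging left and right gives the inverse map.  If a is H-invariant, right
   multiplication by a commutes with the H-action on E, so acting with g on
   h_E(a) gives (the sum of the c_i g |> <x_i, y_i>) times h_E(a), which is
   eps(g) h_E(a).  Since B acts faithfully on E, any other identity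
   h_E(a) = b only needs b . x = x . a. *)
Require Import Defs.
From mathcomp Require Import all_boot all_order all_algebra.
From mathcomp Require Import boolp classical_sets.

Set Implicit Arguments.
Unset Strict Implicit.
Unset Printing Implicit Defensive.

Import GRing.Theory.
Local Open Scope ring_scope.

Lemma central_star (R : realDomainType) (A : starAlgebra R) (a : A) :
  central a -> central (star a).
Proof. by move=> ca x; rewrite -[x]starK -!starM ca. Qed.

Section Intertwined.
Variables (R : realDomainType) (H : hopfStarAlgebra R) (B A : hAlgebra H).
Variable E : bimodule B A.
Implicit Types (x y : E) (a : A) (b : B) (g : H).

(** The graph of h_E kept as a relation, so that the roles of [A] and [B] can be exchanged. *)
Definition intertwined a b := forall x : E, lact b x = ract x a.

Lemma ract_inj a a' : (forall x : E, ract x a = ract x a') -> a = a'.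
Proof.
move=> e; apply/eqP; rewrite -subr_eq0 addrC -scaleN1r; apply/eqP.
by apply: (@ract_faithful _ _ _ _ E) => x; rewrite ractPr e scaleN1r addNr.
Qed.

Lemma intertwined_exists_left a : central a -> exists b, intertwined a b.
Proof.
move=> ca; have [s e] := ipL_full E (1 : B).
exists (\sum_(p <- s) p.1 *: ipL (ract p.2.1 a) p.2.2) => z.
rewrite -[z in RHS]lact1 e !(lin_sum (lact_linl _)) (lin_sum (ract_linl _)).
apply: eq_bigr => p _; rewrite !(lin_Z (lact_linl _)) (lin_Z (ract_linl _)).
(* Centrality gives (x_i . a) . <y_i, z> = (x_i . <y_i, z>) . a. *)
by rewrite !ipLR -!ractA ca.
Qed.

Lemma intertwined_exists_right b : central b -> exists a, intertwined a b.
Proof.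
move=> cb; have [s e] := ipR_full E (1 : A).
exists (\sum_(p <- s) p.1 *: ipR p.2.1 (lact b p.2.2)) => z.
rewrite -[z in LHS]ract1 e !(lin_sum (ract_linr _)) (lin_sum (lact_linr _)).
apply: eq_bigr => p _; rewrite !(lin_Z (ract_linr _)) (lin_Z (lact_linr _)).
by rewrite -!ipLR -!lactA cb.
Qed.

(** Acting by [b] is right multiplication by [a], which commutes with every left multiplication; [B]
    acts faithfully. *)
Lemma intertwined_central_left a b : intertwined a b -> central b.
Proof.
by move=> i b'; apply: (@lact_inj _ _ _ _ E) => x; rewrite !lactA !i lractA.
Qed.

Lemma intertwined_central_right a b : intertwined a b -> central a.
Proof. by move=> i a'; apply: ract_inj => x; rewrite !ractA -!i lractA. Qed.

(** By non-degeneracy, from <y, x . a^*> = a^* <y, x> = <y . a, x> = <b . y, x> = <y, b^* . x>. *)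
Lemma intertwined_star a b : intertwined a b -> intertwined (star a) (star b).
Proof.
move=> i x; have ca := central_star (intertwined_central_right i).
apply: ipR_inj => y.
by rewrite ipR_ract -ca -ipR_ractl -i ipR_lact.
Qed.

(** Invariance turns the second Sweedler leg into a scalar, and the counit axiom collapses the sum
    to [g]. *)
Lemma hact_ract_inv g x a : (forall g', ha_act g' a = ho_eps g' *: a) ->
  hact g (ract x a) = ract (hact g x) a.
Proof.
move=> ia; rewrite hact_ract -[in RHS](ho_counitr g).
rewrite (lin_sum (hact_linl x)) (lin_sum (ract_linl a)).
apply: eq_bigr => p _; rewrite ia (lin_Z (ract_linr _)).
by rewrite (lin_Z (hact_linl x)) (lin_Z (ract_linl a)).
Qed.

Lemma hact_lact_inv g x b : (forall g', ha_act g' b = ho_eps g' *: b) ->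
  hact g (lact b x) = lact b (hact g x).
Proof.
move=> ib; rewrite hact_lact -[in RHS](ho_counitl g).
rewrite (lin_sum (hact_linl x)) (lin_sum (lact_linr b)).
apply: eq_bigr => p _; rewrite ib (lin_Z (lact_linl _)).
by rewrite (lin_Z (hact_linl x)) (lin_Z (lact_linr b)).
Qed.

Lemma intertwined_inv_left a b : intertwined a b ->
  inv_central a -> inv_central b.
Proof.
move=> i [ca ia]; split; first exact: intertwined_central_left i.
move=> g; have [s e] := ipL_full E (1 : B).
(* The goal becomes g |> (b 1) = b (g |> 1), with both units expanded by [e]. *)
rewrite -{1}[b]mulr1 -[ho_eps g *: b]mulr1 -saAl saAr -ha_act_one e mulr_sumr.
rewrite !(lin_sum (ha_actr g)) mulr_sumr; apply: eq_bigr => p _.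
rewrite -saAr !(lin_Z (ha_actr g)) -saAr -ipL_lact i !ipL_hact mulr_sumr.
congr (_ *: _); apply: eq_bigr => q _.
by rewrite hact_ract_inv // -i ipL_lact.
Qed.

Lemma intertwined_inv_right a b : intertwined a b ->
  inv_central b -> inv_central a.
Proof.
move=> i [cb ib]; split; first exact: intertwined_central_right i.
move=> g; have [s e] := ipR_full E (1 : A).
rewrite -{1}[a]mul1r -[ho_eps g *: a]mul1r -saAr saAl -ha_act_one e mulr_suml.
rewrite !(lin_sum (ha_actr g)) mulr_suml; apply: eq_bigr => p _.
rewrite -saAl !(lin_Z (ha_actr g)) -saAl -ipR_ract -i !ipR_hact mulr_suml.
congr (_ *: _); apply: eq_bigr => q _.
by rewrite hact_lact_inv // i ipR_ract.
Qed.

Lemma hmapP a : central a -> intertwined a (hmap E a).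
Proof.
move=> /intertwined_exists_left [b i]; rewrite /hmap.
(* The witness [b] rules out the default value 0 of [xget]. *)
case: xgetP => [b' _ [_ //]|/(_ b)[]].
by split; first exact: intertwined_central_left i.
Qed.

Lemma hmap_eq a b : intertwined a b -> hmap E a = b.
Proof.
move=> i; apply: (@lact_inj _ _ _ _ E) => x.
by rewrite (hmapP (intertwined_central_right i)) i.
Qed.

Lemma hmap_inv_central a : inv_central a -> inv_central (hmap E a).
Proof. by move=> ia; apply: intertwined_inv_left (hmapP ia.1) ia. Qed.

(** Treats the full centers and their invariant parts at once: it suffices that intertwining matches
    [P] with [Q]. *)
Lemma hmap_star_iso_on (P : A -> Prop) (Q : B -> Prop) :
  (forall a, P a -> central a) -> (forall b, Q b -> central b) ->
  (forall a b, intertwined a b -> P a <-> Q b) ->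
  star_iso_on P Q (hmap E).
Proof.
move=> Pc Qc PQ; split=> [a Pa|a a' Pa Pa' e|b Qb|c a a' Pa Pa'|a a' Pa Pa'||a Pa].
- by apply/(PQ a) => //; apply/hmapP/Pc.
- apply: ract_inj => x.
  by rewrite -(hmapP (Pc _ Pa)) e (hmapP (Pc _ Pa')).
- have [a i] := intertwined_exists_right (Qc _ Qb).
  by exists a; [apply/(PQ _ _ i)|apply: hmap_eq].
- apply: hmap_eq => x.
  by rewrite lactPl (hmapP (Pc _ Pa)) (hmapP (Pc _ Pa')) ractPr.
- apply: hmap_eq => x.
  (* The right action yields x . (a' a); centrality of [a'] restores the order. *)
  rewrite lactA (hmapP (Pc _ Pa')) (hmapP (Pc _ Pa)).
  by rewrite -ractA (Pc _ Pa').
- by apply: hmap_eq => x; rewrite lact1 ract1.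
- exact/hmap_eq/intertwined_star/hmapP/Pc.
Qed.

End Intertwined.

Section Functoriality.
Variables (R : realDomainType) (H : hopfStarAlgebra R).
Implicit Types A B D : hAlgebra H.

Lemma hmap_isomorphic A B (E E' : bimodule B A) (a : A) :
  isomorphic E E' -> central a -> hmap E a = hmap E' a.
Proof.
move=> [f fI] ca; apply: hmap_eq => x.
apply: (bij_inj (iso_bij fI)).
by rewrite (iso_lact fI) (iso_ract fI) hmapP.
Qed.

(** On pure tensors, with b = h_E(a), the element h_F(b) sends y (x) x to y . b (x) x = y (x) b . x
    = y (x) x . a. *)
Lemma hmap_btensor A B D (F : bimodule D B) (E : bimodule B A) (a : A) :
  central a -> hmap F (hmap E a) = hmap (btensor F E) a.
Proof.
move=> ca; have iE := hmapP (E := E) ca.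
have iF := hmapP (E := F) (intertwined_central_left iE).
symmetry; apply: hmap_eq; elim/nd_ind => t.
rewrite -[LHS]/(nd_lact _ _) -[RHS]/(nd_ract _ _) nd_lactE nd_ractE.
congr (nd_pi _); rewrite -[LHS]/(T_lact _ _) -[RHS]/(T_ract _ _).
refine (tens_ext (f := T_lact _) (g := fun t => T_ract t a)
  (lin_D (T_lact_linr _)) (lin_D (T_ract_linl a)) _ t) => y x.
by rewrite T_lactE T_ractE iF tens_ract iE.
Qed.

Lemma hmap_id A (a : A) : central a -> hmap (id_bimodule A) a = a.
Proof. by move=> ca; apply: hmap_eq => x; apply: ca. Qed.

Lemma ZH_eq A (a a' : ZH A) : sval a = sval a' -> a = a'.
Proof.
case: a a' => [a ia] [a' ia'] /= e; case: a' / e ia' => ia'.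
by rewrite (Prop_irrelevance ia ia').
Qed.

Lemma pic_clE A B (c : pic B A) : exists E, c = pic_cl E.
Proof. by have [E e] := pic_classP c; exists E; apply: pic_eq => G; rewrite e. Qed.

(** Uses a chosen representative of the class; [pic_act_cl] shows that the choice is immaterial. *)
Definition pic_act B A (c : pic B A) (a : ZH A) : ZH B :=
  exist _ (hmap (sval (cid (pic_clE c))) (sval a))
    (hmap_inv_central _ (proj2_sig a)).

Lemma pic_act_cl A B (E : bimodule B A) (a : ZH A) :
  sval (pic_act (pic_cl E) a) = hmap E (sval a).
Proof.
rewrite /pic_act /=; case: cid => E' /= /esym/pic_clP i.
exact: hmap_isomorphic i (proj2_sig a).1.
Qed.

End Functoriality.

Theorem lemma5p1 (R : realDomainType) (H : hopfStarAlgebra R) :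
  (* h_E : Z(A) -> Z(B) is determined by h_E(a) . x = x . a and is a
     star-isomorphism, which restricts to Z(A)^H -> Z(B)^H *)
  (forall (A B : hAlgebra H) (E : bimodule B A),
    [/\ forall a : A, central a ->
          [/\ central (hmap E a),
              forall x : E, lact (hmap E a) x = ract x a &
              forall b : B, central b ->
                (forall x : E, lact b x = ract x a) -> b = hmap E a],
        star_iso_on (@central R A) (@central R B) (hmap E) &
        star_iso_on (@inv_central R H A) (@inv_central R H B) (hmap E)]) /\
  (* compatibility with isomorphisms, tensor products and identities *)
  [/\ forall (A B : hAlgebra H) (E E' : bimodule B A), isomorphic E E' ->
        forall a : A, central a -> hmap E a = hmap E' a,
      forall (A B D : hAlgebra H) (F : bimodule D B) (E : bimodule B A) (a : A),
        central a -> hmap F (hmap E a) = hmap (btensor F E) a &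
      forall (A : hAlgebra H) (a : A),
        central a -> hmap (id_bimodule A) a = a] /\
  (* the action of the Picard groupoid on invariant central elements *)
  exists h : forall B A : hAlgebra H, pic B A -> ZH A -> ZH B,
    [/\ forall (A B : hAlgebra H) (E : bimodule B A) (a : ZH A),
          sval (h B A (pic_cl E) a) = hmap E (sval a),
        forall (A B D : hAlgebra H) (c : pic D B) (d : pic B A) (a : ZH A),
          h D B c (h B A d a) = h D A (pic_comp c d) a &
        forall (A : hAlgebra H) (a : ZH A),
          h A A (pic_cl (id_bimodule A)) a = a].
Proof.
split=> [A B E|].
  split.
  - move=> a ca; split; [|exact: hmapP|by move=> b _ /hmap_eq].
    exact: intertwined_central_left (hmapP ca).
  - apply: hmap_star_iso_on => // a b i; split=> _.
      exact: intertwined_central_left i.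
    exact: intertwined_central_right i.
  - apply: hmap_star_iso_on => [a []|b []|a b i] //; split.
      exact: intertwined_inv_left i.
    exact: intertwined_inv_right i.
split.
  split=> [A B E E' i a ca|A B D F E a ca|A a ca].
  - exact: hmap_isomorphic.
  - exact: hmap_btensor.
  - exact: hmap_id.
exists (@pic_act R H); split=> [A B E a|A B D c d a|A a].
- exact: pic_act_cl.
- have [F ->] := pic_clE c; have [E ->] := pic_clE d; apply: ZH_eq.
  by rewrite pic_compE !pic_act_cl hmap_btensor //; apply: (proj2_sig a).1.
- by apply: ZH_eq; rewrite pic_act_cl hmap_id //; apply: (proj2_sig a).1.
Qed.
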